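(* For $r,p\in[1,+\infty)$: (1) $E(C[0,1],p)\sim_B E(c_0,p)$; (2) $E(L_r,p)\le_B E(c_0,p)$; (3) for every $q\in[1,+\infty)$, $E(c_0,p)\not\le_B E(L_r,q)$; (4) for $q\in[1,+\infty)$ with $p<q$, $E(c_0,p)<_B E(c_0,q)$.
   Context: $L_r=L_r[0,1]$; $C[0,1]$ has the sup norm and $c_0$ the sup norm. For a separable Banach space $X$ and $p\in[1,\infty)$, $E(X,p)$ is the equivalence relation on $X^{\mathbb N}$ with $(x,y)\in E(X,p)\iff\sum_n\|x(n)-y(n)\|_X^p<+\infty$. $E\le_B F$ means there is a Borel map $\theta$ with $(x,y)\in E\iff(\theta(x),\theta(y))\in F$; $E\sim_BF$ means $E\le_BF$ and $F\le_BE$; $E<_BF$ means $E\le_BF$ and not $F\le_BE$. *)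

(* Defs.v *)
From HB Require Import structures.
From mathcomp Require Import all_boot all_order all_algebra.
From mathcomp Require Import all_classical all_reals all_analysis.
From mathcomp Require Import measurable_realfun ess_sup_inf.

Set Implicit Arguments.
Unset Strict Implicit.
Unset Printing Implicit Defensive.
Import Order.TTheory GRing.Theory Num.Theory.
Import numFieldNormedType.Exports.

Local Open Scope classical_set_scope.
Local Open Scope ring_scope.

Section supnorm.
Context (T : Type) (R : realType).
Implicit Types f g : T -> R.

Definition supnorm f : R := sup (range (fun x => `|f x|)).

Definition bounded_fct f := has_ubound (range (fun x => `|f x|)).

Lemma le_supnorm f x : bounded_fct f -> `|f x| <= supnorm f.
Proof.
move=> bf; apply: sup_upper_bound; last by exists x.
by split => //; exists (`|f x|); exists x.
Qed.

Lemma supnorm_le (a : T) f (M : R) : (forall x, `|f x| <= M) -> supnorm f <= M.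
Proof.
by move=> fM; apply: ge_sup => [|_ [x _ <-]//]; exists (`|f a|); exists a.
Qed.

Lemma supnormD (a : T) f g : bounded_fct f -> bounded_fct g ->
  supnorm (f + g) <= supnorm f + supnorm g.
Proof.
move=> bf bg; apply: (supnorm_le a) => x.
by rewrite (le_trans (ler_normD _ _))// lerD ?le_supnorm.
Qed.

Lemma supnormZ (a : T) (k : R) f : bounded_fct f ->
  supnorm (k *: f) = `|k| * supnorm f.
Proof.
move=> bf; have bkf : bounded_fct (k *: f).
  exists (`|k| * supnorm f) => _ [x _ <-].
  by rewrite normrM ler_wpM2l ?le_supnorm.
apply/le_anti/andP; split.
  by apply: (supnorm_le a) => x; rewrite normrM ler_wpM2l ?le_supnorm.
have [k0|k0] := eqVneq k 0.
  rewrite [in leLHS]k0 normr0 mul0r.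
  exact: le_trans (normr_ge0 _) (le_supnorm a bkf).
rewrite -ler_pdivlMl ?normr_gt0//; apply: (supnorm_le a) => x.
rewrite ler_pdivlMl ?normr_gt0// -normrM.
exact: (le_supnorm x bkf).
Qed.

Lemma supnorm_eq0 f : bounded_fct f -> supnorm f = 0 -> f = 0.
Proof.
move=> bf f0; apply/funext => x; apply/normr0_eq0/le_anti.
by rewrite normr_ge0 andbT -f0 le_supnorm.
Qed.

End supnorm.

Section c0.
Variable R : realType.

Definition null_sequence : {pred nat -> R} :=
  fun u => `[< u @ \oo --> (0 : R) >].

Record c0 := C0 { c0_seq :> nat -> R ; _ : c0_seq \in null_sequence }.

HB.instance Definition _ := [isSub for c0_seq].
HB.instance Definition _ := [Choice of c0 by <:].

Let c0_closed : submod_closed null_sequence.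
Proof.
split; first by apply/asboolP; exact: cvg_cst.
move=> a u v /asboolP u0 /asboolP v0; apply/asboolP.
by have := cvgD (cvgZl_tmp (k := a) u0) v0; rewrite scaler0 addr0; exact.
Qed.

HB.instance Definition _ :=
  GRing.isSubmodClosed.Build _ _ null_sequence c0_closed.
HB.instance Definition _ := [SubChoice_isSubLmodule of c0 by <:].

Lemma c0_bounded (u : c0) : bounded_fct u.
Proof.
case: u => u /= /asboolP u0.
have /cvg_seq_bounded/= [M [_ Mu]] : cvgn u by apply/cvg_ex; exists 0.
exists (M + 1) => _ [n _ <-]; apply: Mu => //.
by rewrite ltrDl.
Qed.

Let c0_normD (u v : c0) : supnorm (u + v : c0) <= supnorm u + supnorm v.
Proof. by apply: (supnormD 0%N); exact: c0_bounded. Qed.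

Let c0_normZ (k : R) (u : c0) : supnorm (k *: u : c0) = `|k| * supnorm u.
Proof. by apply: (supnormZ 0%N); exact: c0_bounded. Qed.

Let c0_norm_eq0 (u : c0) : supnorm u = 0 -> u = 0.
Proof. by move=> /(supnorm_eq0 (c0_bounded u)) u0; exact: val_inj. Qed.

HB.instance Definition _ :=
  Lmodule_isNormed.Build R c0 c0_normD c0_normZ c0_norm_eq0.

Lemma c0_normE (u : c0) : `|u| = supnorm u. Proof. by []. Qed.

End c0.

Section C01.
Variable R : realType.

Let I01 := set_type (`[0, 1]%classic : set R).

Definition continuous01 : {pred I01 -> R} := fun f => `[< continuous f >].

Record C01 := MkC01 { C01_fun :> I01 -> R ; _ : C01_fun \in continuous01 }.

HB.instance Definition _ := [isSub for C01_fun].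
HB.instance Definition _ := [Choice of C01 by <:].

Let C01_closed : submod_closed continuous01.
Proof.
split; first by apply/asboolP => x; exact: (@cst_continuous I01 R 0).
move=> a f g /asboolP cf /asboolP cg; apply/asboolP => x.
exact: cvgD (cvgZl_tmp (k := a) (cf x)) (cg x).
Qed.

HB.instance Definition _ :=
  GRing.isSubmodClosed.Build _ _ continuous01 C01_closed.
HB.instance Definition _ := [SubChoice_isSubLmodule of C01 by <:].

Let zero01 : I01.
Proof.
suff x : (0 : R) \in `[0, 1]%classic by exact: exist _ 0 x.
by rewrite inE/= in_itv/= lexx ler01.
Qed.

Lemma C01_bounded (f : C01) : bounded_fct f.
Proof.
case: f => f /= /asboolP cf.
have /subspace_valL_continuousP : continuous f by [].
move=> /continuous_compact /(_ (@segment_compact R 0 1)).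
move=> /compact_bounded[M [_ Mf]].
exists (M + 1) => _ [x _ <-]; apply: (Mf (M + 1)); first by rewrite ltrDl.
exists (val x); first exact: set_valP.
by have := @valLK _ _ (point : R) _ f; move/(congr1 (@^~ x)).
Qed.

Let C01_normD (f g : C01) : supnorm (f + g : C01) <= supnorm f + supnorm g.
Proof. by apply: (supnormD zero01); exact: C01_bounded. Qed.

Let C01_normZ (k : R) (f : C01) : supnorm (k *: f : C01) = `|k| * supnorm f.
Proof. by apply: (supnormZ zero01); exact: C01_bounded. Qed.

Let C01_norm_eq0 (f : C01) : supnorm f = 0 -> f = 0.
Proof. by move=> /(supnorm_eq0 (C01_bounded f)) f0; exact: val_inj. Qed.

HB.instance Definition _ :=
  Lmodule_isNormed.Build R C01 C01_normD C01_normZ C01_norm_eq0.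

Lemma C01_normE (f : C01) : `|f| = supnorm f. Proof. by []. Qed.

End C01.

Section Lspace.
Context d (T : measurableType d) (R : realType).
Variables (mu : {measure set T -> \bar R}) (p : \bar R) (p1 : (1 <= p)%E).

Local Notation L := (LfunType mu p1).
Local Notation Lsp := (LspaceType mu p1).
Local Open Scope quotient_scope.

Lemma Lnorm_ae_eq (f g : {mfun T >-> R}) : f = g %[ae mu] ->
  ('N[mu]_p[EFin \o f] = 'N[mu]_p[EFin \o g])%E.
Proof.
move=> fg; rewrite unlock /Lnorm; case: p p1 => [r r1|_|//].
  have mr (h : {mfun T >-> R}) :
      measurable_fun setT (fun x => (`|(EFin \o h) x| `^ r)%E).
    apply: (@measurableT_comp _ _ _ _ _ _ (fun x => x `^ r)%E).
      exact: measurable_poweR.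
    by apply: measurableT_comp => //; exact/measurable_EFinP.
  congr (_ `^ _)%E; apply: ge0_ae_eq_integral => //; try exact: mr.
    by move=> x _; exact: poweR_ge0.
    by move=> x _; exact: poweR_ge0.
  by apply: filterS fg => x /[apply]/= ->.
case: ifPn => // _; apply: eq_ess_sup.
by apply: filterS fg => x /(_ I)/= ->.
Qed.

(* [LfunType] is built on measurable functions into [R] with its default
   measurable structure, [LspaceType] on measurable functions into
   [measurableTypeR R]. The sigma-algebras coincide but the structures do not
   unify; [to_Rm] and [of_Rm] are the identity between the two. *)
Local Notation Rm := (measurableTypeR R).

Definition to_Rm (f : T -> R) : T -> Rm := f.

HB.instance Definition _ (f : {mfun T >-> R}) :=
  @isMeasurableFun.Build _ _ T Rm (to_Rm f) (@measurable_funPT _ _ T R f).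

Definition of_Rm (f : T -> Rm) : T -> R := f.

HB.instance Definition _ (f : {mfun T >-> Rm}) :=
  @isMeasurableFun.Build _ _ T R (of_Rm f) (@measurable_funPT _ _ T Rm f).

Definition ae_class (f : L) : {mfun_ mu, T >-> Rm} :=
  \pi_({mfun_ mu, T >-> Rm}) (to_Rm f).

Lemma repr_ae_class (f : L) : (ae_class f : T -> R) = f %[ae mu].
Proof.
by have /eqP := reprK (ae_class f); rewrite eqmodE => /asboolP.
Qed.

Let ae_class_finite (f : L) : finite_norm mu p (ae_class f).
Proof.
rewrite /finite_norm.
have -> := @Lnorm_ae_eq (of_Rm (repr (ae_class f))) f (repr_ae_class f).
exact: Lfunction_finite.
Qed.

HB.instance Definition _ (f : L) :=
  isFinLebesgue.Build d T R mu p p1 (ae_class f) (ae_class_finite f).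

Definition Lspace_class (f : L) : Lsp := ae_class f.

HB.instance Definition _ (F : Lsp) :=
  @isLfunction.Build d T R mu p p1 (of_Rm (repr (F : {mfun_ mu, T >-> Rm})))
    (@Lebesgue_finite _ _ _ _ _ _ F).

Definition Lspace_repr (F : Lsp) : L := of_Rm (repr (F : {mfun_ mu, T >-> Rm})).

Lemma Lspace_inj (F G : Lsp) :
  (F : {mfun_ mu, T >-> Rm}) = (G : {mfun_ mu, T >-> Rm}) -> F = G.
Proof.
case: F => F [[Fp]]; case: G => G [[Gp]] /= FG.
by subst G; rewrite (Prop_irrelevance Fp Gp).
Qed.

Lemma Lspace_classP (f g : L) :
  Lspace_class f = Lspace_class g <-> f = g %[ae mu].
Proof.
split=> [fg|fg]; last first.
  by apply: Lspace_inj => /=; apply/eqP; rewrite eqmodE; exact/asboolP.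
apply: ae_eq_trans (repr_ae_class g).
apply: ae_eq_sym.
have := repr_ae_class f.
by rewrite -[ae_class f]/(Lspace_class f : {mfun_ mu, T >-> Rm}) fg.
Qed.

Lemma Lspace_reprK : cancel Lspace_repr Lspace_class.
Proof.
move=> F; apply: Lspace_inj => /=; rewrite -[RHS]reprK.
by apply/eqP; rewrite eqmodE; apply/asboolP; exact: ae_eq_refl.
Qed.

Lemma Lspace_classK (f : L) : Lspace_repr (Lspace_class f) = f %[ae mu].
Proof. exact: repr_ae_class. Qed.

HB.instance Definition _ := gen_eqMixin Lsp.
HB.instance Definition _ := gen_choiceMixin Lsp.

Let zero : Lsp := Lspace_class 0.
Let opp (F : Lsp) := Lspace_class (- Lspace_repr F).
Let add (F G : Lsp) := Lspace_class (Lspace_repr F + Lspace_repr G).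
Let scale (a : R) (F : Lsp) := Lspace_class (a *: Lspace_repr F).

Let addE (f g : L) :
  add (Lspace_class f) (Lspace_class g) = Lspace_class (f + g).
Proof.
apply/Lspace_classP; apply: filterS2 (Lspace_classK f) (Lspace_classK g).
by move=> x /(_ I)/= fE /(_ I)/= gE _; congr (_ + _).
Qed.

Let oppE (f : L) : opp (Lspace_class f) = Lspace_class (- f).
Proof.
apply/Lspace_classP; apply: filterS (Lspace_classK f).
by move=> x /(_ I)/= fE _; congr (- _).
Qed.

Let scaleE a (f : L) : scale a (Lspace_class f) = Lspace_class (a *: f).
Proof.
apply/Lspace_classP; apply: filterS (Lspace_classK f).
by move=> x /(_ I)/= fE _; congr (_ * _).
Qed.

Let addA : associative add.
Proof.
move=> F G H; rewrite -(Lspace_reprK F) -(Lspace_reprK G) -(Lspace_reprK H).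
by rewrite !addE addrA.
Qed.

Let addC : commutative add.
Proof. by move=> F G; rewrite /add addrC. Qed.

Let add0 : left_id zero add.
Proof. by move=> F; rewrite -(Lspace_reprK F) addE add0r. Qed.

Let addN : left_inverse zero opp add.
Proof. by move=> F; rewrite -(Lspace_reprK F) oppE addE addNr. Qed.

HB.instance Definition _ := GRing.isZmodule.Build Lsp addA addC add0 addN.

Let scaleA a b F : scale a (scale b F) = scale (a * b) F.
Proof. by rewrite -(Lspace_reprK F) !scaleE scalerA. Qed.

Let scale1 : left_id 1 scale.
Proof. by move=> F; rewrite -(Lspace_reprK F) scaleE scale1r. Qed.

Let scaleDr : right_distributive scale +%R.
Proof.
move=> a F G; rewrite -(Lspace_reprK F) -(Lspace_reprK G).
by rewrite [X in scale a X]addE !scaleE scalerDr; exact/esym/addE.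
Qed.

Let scaleDl F : {morph scale^~ F : a b / a + b}.
Proof.
move=> a b; rewrite -(Lspace_reprK F) !scaleE scalerDl.
exact/esym/addE.
Qed.

HB.instance Definition _ :=
  GRing.Zmodule_isLmodule.Build R Lsp scaleA scale1 scaleDr scaleDl.

Definition Lspace_norm (F : Lsp) : R := fine 'N[mu]_p[EFin \o Lspace_repr F]%E.

Let norm_class (f : L) :
  Lspace_norm (Lspace_class f) = fine 'N[mu]_p[EFin \o f]%E.
Proof. by congr fine; exact/Lnorm_ae_eq/Lspace_classK. Qed.

Let Lspace_normD (F G : Lsp) :
  Lspace_norm (F + G) <= Lspace_norm F + Lspace_norm G.
Proof. by rewrite [X in X <= _]norm_class; exact: ler_LnormD. Qed.

Let Lspace_normZ a (F : Lsp) : Lspace_norm (a *: F) = `|a| * Lspace_norm F.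
Proof.
rewrite [LHS]norm_class; apply: EFin_inj.
by rewrite EFinM !finite_norm_fine -LnormZ.
Qed.

Let Lspace_norm_eq0 (F : Lsp) : Lspace_norm F = 0 -> F = 0.
Proof.
move=> /fine_Lnormr_eq0 F0; rewrite -(Lspace_reprK F).
exact/Lspace_classP.
Qed.

HB.instance Definition _ := Lmodule_isNormed.Build R Lsp
  Lspace_normD Lspace_normZ Lspace_norm_eq0.

Lemma Lspace_classD (f g : L) :
  Lspace_class (f + g) = Lspace_class f + Lspace_class g.
Proof. exact/esym/addE. Qed.

Lemma Lspace_classZ a (f : L) : Lspace_class (a *: f) = a *: Lspace_class f.
Proof. exact/esym/scaleE. Qed.

Lemma Lspace_normE (F : Lsp) :
  `|F| = fine 'N[mu]_p[EFin \o Lspace_repr F]%E.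
Proof. by []. Qed.

Lemma Lspace_norm_class (f : L) :
  `|Lspace_class f| = fine 'N[mu]_p[EFin \o f]%E.
Proof. exact: norm_class. Qed.

End Lspace.

Definition lebesgue01 (R : realType) : set (measurableTypeR R) -> \bar R :=
  mrestr (@lebesgue_measure R) (measurable_itv `[0, 1]).
HB.instance Definition _ (R : realType) := Measure.on (@lebesgue01 R).

(* $L_r[0,1]$: functions are defined on all of $\mathbb{R}$, but [lebesgue01]
   does not charge the complement of $[0,1]$, so that their classes modulo
   almost-everywhere equality are determined by their values on $[0,1]$. *)
Definition Lr (R : realType) (r : R) (r1 : 1 <= r) :=
  @LspaceType _ (measurableTypeR R) R (@lebesgue01 R) r%:E r1.

(* [{ptws nat -> X}] carries the product topology. *)
Definition E (R : realType) (X : normedModType R) (p : R)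
    (x y : {ptws nat -> X}) : Prop :=
  (\sum_(0 <= n <oo) (`|x n - y n| `^ p)%:E < +oo)%E.
Arguments E {R} X p x y.

Definition borel_set (T : topologicalType) : set (set T) := <<s open >>.

Definition borel_map (S T : topologicalType) (theta : S -> T) : Prop :=
  forall B, borel_set B -> borel_set (theta @^-1` B).

Definition borel_reducible (S T : topologicalType)
    (E : S -> S -> Prop) (F : T -> T -> Prop) : Prop :=
  exists2 theta : S -> T,
    borel_map theta & forall x y, E x y <-> F (theta x) (theta y).

Definition borel_bireducible (S T : topologicalType)
    (E : S -> S -> Prop) (F : T -> T -> Prop) : Prop :=
  borel_reducible E F /\ borel_reducible F E.

Definition borel_strictly_reducible (S T : topologicalType)
    (E : S -> S -> Prop) (F : T -> T -> Prop) : Prop :=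
  borel_reducible E F /\ ~ borel_reducible F E.

(* Main.v *)
Require Import Defs.
From mathcomp Require Import all_boot all_order all_algebra.
From mathcomp Require Import all_classical all_reals all_analysis.
From mathcomp Require Import measurable_realfun.
From mathcomp Require Import ring lra zify.

Set Implicit Arguments.
Unset Strict Implicit.
Unset Printing Implicit Defensive.
Import Order.TTheory GRing.Theory Num.Theory.
Import numFieldNormedType.Exports.

Local Open Scope classical_set_scope.
Local Open Scope ring_scope.

(* Reductions. A separable metric space (M, d) embeds bi-Lipschitzly into c_0
   (Aharoni). For d = ||x - y||^(p/q) with p <= q, applying such an embedding in
   every coordinate reduces E(X, p) to E(c_0, q) for each separable X.

   Additive form of a reduction. Let theta reduce E(X, p) to E(Y, q), and let
   finite sets F_j of X be given. On a comeager set of sequences over a countable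
   subset of X, theta is continuous. Inserting suitable fixed words between the
   entries x_j of a sequence in prod F_j, one makes theta on the j-th of a
   sequence of consecutive blocks of coordinates depend only on x_j, up to
   summable errors. Hence there are psi_j from F_j to finite l_q-sums of Y with
   sum ||x_j - y_j||^p < oo iff sum ||psi_j x_j - psi_j y_j||^q < oo.

   Non-reducibility to L_r. Take for F_j the square matrices of size 2^(j+1) + 1
   over the field with two elements, with the metric 2^(-j) rank(A - B). The
   random walk adding rank one matrices has spectral gap 1/2, and most pairs are
   at rank distance above 2^j. The Poincare inequality extrapolates to L_r-valued
   functions and every exponent, so some pair at distance at least 1 has, up to a
   constant, an image no longer than that of some pair at distance at most
   2^(-j): the former sum diverges while the latter converges.

   Strictness in the exponent. For p < q and a reduction of E(c_0, q) to
   E(c_0, p), cut a segment of length 1 into 2^l steps: by bisection some step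
   has an image of p-th power at least a constant times 2^(-pl), while its own
   q-th power is 2^(-ql); choose the l_j so that sum 2^(-q l_j) < oo and
   sum 2^(-p l_j) = oo. *)

(** * Summability *)

Section bounded_series.
Variable R : realType.
Implicit Types a b : nat -> R.

Definition bddsum a := exists M, forall n, \sum_(i < n) a i <= M.

Lemma bddsum_le a b : (forall i, a i <= b i) -> bddsum b -> bddsum a.
Proof.
move=> ab [M bM]; exists M => n; apply: le_trans (bM n).
by apply: ler_sum => i _; exact: ab.
Qed.

Lemma bddsumD a b : bddsum a -> bddsum b -> bddsum (fun i => a i + b i).
Proof.
move=> [M aM] [N bN]; exists (M + N) => n.
by rewrite big_split lerD.
Qed.

Lemma bddsumZ (c : R) a : 0 <= c -> bddsum a -> bddsum (fun i => c * a i).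
Proof.
move=> c0 [M aM]; exists (c * M) => n.
by rewrite -mulr_sumr ler_wpM2l.
Qed.

Lemma bddsum_geometric : bddsum (fun i => 2 ^- i : R).
Proof.
exists 2 => n; rewrite (_ : \sum_(i < n) _ = 2 - 2 * 2 ^- n).
  by rewrite lerBlDr lerDl mulr_ge0// invr_ge0 exprn_ge0.
elim: n => [|n IH]; first by rewrite big_ord0 expr0 invr1 mulr1 subrr.
rewrite big_ord_recr/= IH exprS invfM.
by have := 2 ^- n : R; move=> x; lra.
Qed.

Lemma ler_sum_prefix a m n : (forall i, 0 <= a i) -> (m <= n)%N ->
  \sum_(i < m) a i <= \sum_(i < n) a i.
Proof.
move=> a0 mn; rewrite -!(big_mkord xpredT) [leRHS](big_cat_nat (n := m))//=.
by rewrite lerDl sumr_ge0.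
Qed.

(** Partial sums of nonnegative terms increase, so a bound along cofinal indices is enough. This is
    how sums over coordinates are exchanged for sums over blocks. *)
Lemma bddsum_subseq a (L : nat -> nat) : (forall i, 0 <= a i) ->
  (forall j, (j <= L j)%N) ->
  bddsum a <-> exists M, forall j, \sum_(i < L j) a i <= M.
Proof.
move=> a0 Lj; split=> [[M aM]|[M aM]]; exists M => n; first exact: aM.
exact: le_trans (ler_sum_prefix a0 (Lj n)) (aM n).
Qed.

Lemma bddsum_ge a (c : R) : 0 < c -> (forall i, c <= a i) -> ~ bddsum a.
Proof.
move=> c0 ca [M aM].
have [n nM] : exists n, M < c * n%:R.
  exists (Num.truncn (M / c)).+1; rewrite mulrC -ltr_pdivrMr//.
  exact: truncnS_gt.
have := aM n; rewrite leNgt => /negP; apply; apply: lt_le_trans nM _.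
rewrite mulr_natr -[n in X in X <= _]card_ord -sumr_const.
by apply: ler_sum => i _; exact: ca.
Qed.

Lemma nneseries_lty a : (forall i, 0 <= a i) ->
  (\sum_(0 <= n <oo) (a n)%:E < +oo)%E <-> bddsum a.
Proof.
move=> a0; split=> [aoo|[M aM]].
  have ge0 : (0 <= \sum_(0 <= n <oo) (a n)%:E)%E.
    by apply: nneseries_ge0 => n _ _; rewrite lee_fin.
  exists (fine (\sum_(0 <= n <oo) (a n)%:E)%E) => n.
  rewrite -lee_fin fineK ?ge0_fin_numE// -sumEFin.
  rewrite -(big_mkord xpredT (fun i => (a i)%:E)).
  by apply: nneseries_lim_ge => i _ _; rewrite lee_fin.
apply: (@le_lt_trans _ _ M%:E); last exact: ltry.
apply: lime_le.
  by apply: is_cvg_nneseries => n _ _; rewrite lee_fin.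
apply: nearW => n; rewrite sumEFin lee_fin big_mkord; exact: aM.
Qed.

End bounded_series.

(** * Reductions induced by coordinatewise maps *)

Section E_reductions.
Variable R : realType.

Lemma E_bddsum (X : normedModType R) p (x y : {ptws nat -> X}) :
  E X p x y <-> bddsum (fun n => `|x n - y n| `^ p).
Proof. by apply: nneseries_lty => i; exact: powR_ge0. Qed.

(** The sets with preimage in [A] form a sigma-algebra. [A] is left general because it is used both
    for Borel sets and for sets with the Baire property. *)
Lemma borel_set_preimage (S : Type) (T : topologicalType) (f : S -> T)
    (A : set (set S)) : sigma_algebra [set: S] A ->
  (forall U, open U -> A (f @^-1` U)) ->
  forall B, borel_set B -> A (f @^-1` B).
Proof.
move=> sA oA; suff : borel_set (T := T) `<=` image_set_system setT f A.
  by move=> + B bB => /(_ B bB); rewrite /image_set_system/= setTI.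
apply: smallest_sub => [|U oU]; first exact: sigma_algebra_image.
by rewrite /image_set_system/= setTI; exact: oA.
Qed.

Lemma continuous_borel_map (S T : topologicalType) (f : S -> T) :
  continuous f -> borel_map f.
Proof.
move=> /continuousP cf; apply: borel_set_preimage.
  exact: smallest_sigma_algebra.
by move=> U oU; apply: sub_sigma_algebra; exact: cf.
Qed.

Lemma ptws_map_continuous (X Y : normedModType R) (f : X -> Y) :
  continuous f ->
  continuous ((fun x n => f (x n)) : {ptws nat -> X} -> {ptws nat -> Y}).
Proof.
move=> cf x.
have H := @pointwise_cvgP nat Y _ (fun n => f (x n))
  (fmap_filter (fun (y : {ptws nat -> X}) n => f (y n)) (nbhs_filter x)).
apply: (proj2 H) => t /=.
apply: (@cvg_comp _ _ _ (fun y : {ptws nat -> X} => y t) f _ (nbhs (x t))).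
  exact: (@proj_continuous nat (fun=> X) t x).
exact: cf.
Qed.

Lemma reducible_of_embedding (X Y : normedModType R) (p q c C : R)
    (f : X -> Y) : 0 < c -> continuous f ->
  (forall x y, c * `|x - y| `^ p <= `|f x - f y| `^ q) ->
  (forall x y, `|f x - f y| `^ q <= C * `|x - y| `^ p) ->
  borel_reducible (E X p) (E Y q).
Proof.
move=> c0 cf lo up.
exists ((fun x n => f (x n)) : {ptws nat -> X} -> {ptws nat -> Y}).
  by apply: continuous_borel_map; exact: ptws_map_continuous.
move=> x y; rewrite !E_bddsum; split => xy.
  apply: (@bddsum_le _ _ (fun n => `|C| * `|x n - y n| `^ p)).
    move=> i; apply: le_trans (up _ _) _; rewrite ler_wpM2r ?powR_ge0//.
    exact: ler_norm.
  exact: bddsumZ.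
apply: (@bddsum_le _ _ (fun n => c^-1 * `|f (x n) - f (y n)| `^ q)).
  by move=> i; rewrite ler_pdivlMl// lo.
by apply: bddsumZ => //; rewrite invr_ge0 ltW.
Qed.

End E_reductions.

(** * Aharoni's theorem *)

Section c0_facts.
Variable R : realType.
Implicit Types u v : c0 R.

Lemma c0_subE u v n : (u - v) n = u n - v n.
Proof. by []. Qed.

Lemma c0_norm_le u M : (forall n, `|u n| <= M) -> `|u| <= M.
Proof. by move=> uM; rewrite c0_normE; exact: (supnorm_le 0%N). Qed.

Lemma c0_norm_ge u n : `|u n| <= `|u|.
Proof. by rewrite c0_normE; apply: le_supnorm; exact: c0_bounded. Qed.

Lemma null_sequenceP (u : nat -> R) :
  (forall e, 0 < e -> exists N, forall n, (N <= n)%N -> `|u n| <= e) ->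
  u \in @null_sequence R.
Proof.
move=> H; apply/asboolP/cvgrPdist_le => e e0.
have [N HN] := H e e0; exists N => // n /= Nn.
by rewrite sub0r normrN; exact: HN.
Qed.

Lemma c0_cvg u e : 0 < e -> exists N, forall n, (N <= n)%N -> `|u n| <= e.
Proof.
case: u => u /= /asboolP /cvgrPdist_le H e0.
have [N _ HN] := H e e0; exists N => n Nn.
by have := HN n Nn; rewrite sub0r normrN.
Qed.

End c0_facts.

Section dyadic_scales.
Variable R : realType.

Lemma expr2_ge (x : R) : exists n : nat, x <= 2 ^+ n.
Proof.
exists (Num.truncn x).+1; apply: ltW; apply: lt_le_trans (truncnS_gt x) _.
by rewrite -natrX ler_nat ltnW// ltn_expl.
Qed.

Lemma expr2V_le (e : R) : 0 < e -> exists n : nat, 2 ^- n <= e.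
Proof.
move=> e0; have [n H] := expr2_ge e^-1; exists n.
by rewrite -[e]invrK lef_pV2// posrE ?invr_gt0// exprn_gt0.
Qed.

(** Exponents are shifted by some [a] with 2^-a <= r, which turns the search over integers into one
    for a least natural number m with r < 2^(m - a); this m is positive and m - 1 - a is the
    exponent wanted. *)
Lemma dyadic_floor (r : R) : 0 < r ->
  exists k : int, (2 : R) ^ k <= r < 2 * 2 ^ k.
Proof.
move=> r0; have [a ar] := expr2V_le r0.
have [b br] := expr2_ge (r + 1).
have {br} exP : exists m : nat, r < 2 ^ ((m : int) - a%:Z).
  exists (b + a)%N; rewrite PoszD addrK.
  by apply: lt_le_trans br; rewrite ltrDl.
case: (ex_minnP exP) => m rm mmin.
have m0 : (0 < m)%N.
  rewrite lt0n; apply: contraTneq rm => ->.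
  by rewrite sub0r -exprnN -leNgt.
have mS : m%:Z = m.-1%:Z + 1 by rewrite -{1}(prednK m0) -addn1 PoszD.
exists (m.-1%:Z - a%:Z); apply/andP; split.
  by rewrite leNgt; apply/negP => /mmin; rewrite -ltnS prednK// ltnn.
suff -> : 2 * (2 : R) ^ (m.-1%:Z - a%:Z) = 2 ^ (m%:Z - a%:Z) by [].
by rewrite mS addrAC [RHS]expfzDr ?pnatr_eq0// expr1z mulrC.
Qed.

End dyadic_scales.

Section Aharoni.
Variables (R : realType) (T : Type) (d : T -> T -> R) (e : nat -> T).
Hypothesis d0 : forall x y, 0 <= d x y.
Hypothesis dC : forall x y, d x y = d y x.
Hypothesis d_triangle : forall x y z, d x z <= d x y + d y z.
Hypothesis e_dense : forall x r, 0 < r -> exists i, d x (e i) <= r.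

Let o := e 0%N.

(* [bump rho i] equals [rho] at the points of the ball B(e_i, 2 rho) that avoid
   the previous balls and B(o, 2 rho), and vanishes beyond distance 3 rho of e_i.
   At a given point and scale only finitely many bumps do not vanish, since some
   e_j is within rho of it; scales that are large for the point contribute
   nothing, and small ones little. *)
Let bump (rho : R) (i : nat) (x : T) : R :=
  Num.max 0 (Num.min (Num.min (3 * rho - d x (e i)) (d x o - rho))
                     (\big[Num.min/rho]_(j < i) (d x (e j) - rho))).

(** Each distance function is 1-Lipschitz, and minima and maxima preserve this; by symmetry a
    one-sided estimate is enough. *)
Let bump_lip rho i x y : `|bump rho i x - bump rho i y| <= d x y.
Proof.
wlog suff H : x y / bump rho i x <= bump rho i y + d x y.
  by rewrite ler_norml; have := H x y; have := H y x; rewrite (dC y x); lra.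
have minD (a b a' b' c : R) : a <= a' + c -> b <= b' + c ->
    Num.min a b <= Num.min a' b' + c.
  by rewrite addr_minl le_min => aa bb; rewrite !ge_min aa bb orbT.
rewrite /bump addr_maxl ge_max; apply/andP; split.
  by rewrite le_max add0r d0.
rewrite le_max; apply/orP; right; apply: (minD); first apply: (minD).
- by have := d_triangle y x (e i); rewrite (dC y x); lra.
- by have := d_triangle x y o; lra.
- apply: (big_ind2 (fun a b => a <= b + d x y)) => [||j _].
  + by rewrite lerDl.
  + by move=> *; exact: minD.
  + by have := d_triangle x y (e j); lra.
Qed.

Let bump_ge0 rho i x : 0 <= bump rho i x.
Proof. by rewrite /bump le_max lexx. Qed.

Let bump_le rho i x : 0 <= rho -> bump rho i x <= rho.
Proof.
move=> r0; rewrite /bump ge_max r0/= ge_min; apply/orP; right.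
exact: bigmin_le_id.
Qed.

Let bump0_near rho i x : d x o <= rho -> bump rho i x = 0.
Proof.
move=> xo; apply/le_anti; rewrite bump_ge0 andbT /bump ge_max lexx/=.
by rewrite !ge_min !subr_le0 xo orbT.
Qed.

Let bump0_late rho i j x : (j < i)%N -> d x (e j) <= rho -> bump rho i x = 0.
Proof.
move=> ji xj; apply/le_anti; rewrite bump_ge0 andbT /bump ge_max lexx/=.
rewrite ge_min; apply/orP; right.
by apply: (bigmin_inf (Ordinal ji)) => //=; rewrite subr_le0.
Qed.

Let bump0_far rho i x : 3 * rho <= d x (e i) -> bump rho i x = 0.
Proof.
move=> xi; apply/le_anti; rewrite bump_ge0 andbT /bump ge_max lexx/=.
by rewrite !ge_min !subr_le0 xi.
Qed.

Let bump_top rho i x : 0 < rho -> 2 * rho <= d x o -> d x (e i) < 2 * rho ->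
  (forall j, (j < i)%N -> 2 * rho <= d x (e j)) -> bump rho i x = rho.
Proof.
move=> rho0 xo xi ximin; apply/le_anti; apply/andP; split.
  exact/bump_le/ltW.
rewrite /bump le_max; apply/orP; right; rewrite !le_min; apply/andP; split.
  by apply/andP; lra.
by apply/bigmin_geP; split => // j _; have := ximin j (ltn_ord j); lra.
Qed.

Let coord (x : T) (n : nat) : R :=
  if @pickle_inv (int * nat)%type n is Some (k, i) then bump (2 ^ k) i x else 0.

Let coord_null x : coord x \in @null_sequence R.
Proof.
apply: null_sequenceP => r r0.
have [a ar] := expr2V_le r0.
have [b bx] := expr2_ge (d x o).
have /choice[late lateP] : forall k : int, exists i, d x (e i) <= 2 ^ k.
  by move=> k; apply: e_dense; exact: exprz_gt0.
pose lvl (m : nat) : int := m%:Z - a%:Z.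
(* The bound exceeds the codes of all pairs (k, i) with -a <= k < b and i <= [late k]. For any other
   pair the scale is at most r, or the point is near [o] at that scale, or the bump comes too
   late. *)
exists (\max_(m < a + b) \max_(i < (late (lvl m)).+1)
  (pickle (lvl m, i : nat)).+1)%N => n Nn.
rewrite /coord; case E : (pickle_inv _) => [[k i]|]; last by rewrite normr0 ltW.
have nE : n = pickle (k, i).
  by have := @pickle_invK (int * nat)%type n; rewrite E/=.
rewrite ger0_norm//; have [ka|ka] := leP k (- a%:Z).
  apply: le_trans ar; rewrite (le_trans (bump_le _ _ _))// ?exprz_ge0//.
  by rewrite exprnN ler_weXz2l// ler1n.
have [kb|kb] := leP b%:Z k.
  rewrite bump0_near; first exact: ltW.
  apply: le_trans bx _.
  by rewrite [leLHS]exprnP ler_weXz2l// ler1n.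
have [il|il] := ltnP (late k) i.
  by rewrite (bump0_late il (lateP k)) ltW.
exfalso; have km : (`|((k : int) + a%:Z)%R| < a + b)%N by lia.
have kE : k = lvl `|((k : int) + a%:Z)%R|%N by rewrite /lvl; lia.
move: Nn; apply/negP; rewrite -ltnNge nE.
apply: leq_trans (leq_bigmax (Ordinal km)) => /=; rewrite -kE.
have im : (i < (late k).+1)%N by [].
exact: leq_trans (leq_bigmax (Ordinal im)).
Qed.

Theorem Aharoni : exists f : T -> c0 R,
  forall x y, d x y / 10 <= `|f x - f y| <= d x y.
Proof.
exists (fun x => C0 (coord_null x)) => x y; apply/andP; split; last first.
  apply: c0_norm_le => n; rewrite c0_subE /= /coord.
  by case: (pickle_inv _) => [[k i]|]; rewrite ?subr0 ?normr0 ?bump_lip.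
wlog xoy : x y / d y o <= d x o.
  have [xy|/ltW xy] := leP (d y o) (d x o) => H; first exact: H.
  by rewrite dC distrC; exact: H.
have [dxy0|dxy0] := eqVneq (d x y) 0; first by rewrite dxy0 mul0r.
have {dxy0} : 0 < d x y / 5 by rewrite divr_gt0// lt_neqAle eq_sym dxy0 d0.
(* Now 5 rho <= d x y < 10 rho. A centre within 2 rho of x is at least 3 rho away from y, and x, the
   farther of the two points from [o], is at least 2 rho away from [o]: one bump equals rho at x and
   0 at y. *)
move=> /dyadic_floor[k]; set rho := 2 ^ k => /andP[rho_le lt_rho].
have rho0 : 0 < rho by exact: exprz_gt0.
have exi : exists i, d x (e i) < 2 * rho.
  have [i xi] := e_dense x rho0; exists i; lra.
case: (ex_minnP exi) => i xi imin.
have {exi} bx : bump rho i x = rho.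
  apply: bump_top => //; first by have := d_triangle x o y; rewrite (dC o y); lra.
  by move=> j ji; rewrite leNgt; apply/negP => /imin; rewrite leqNgt ji.
have by0 : bump rho i y = 0.
  by apply: bump0_far; have := d_triangle x (e i) y; rewrite (dC (e i) y); lra.
apply: le_trans (c0_norm_ge _ (pickle (k, i))).
rewrite c0_subE/= /coord pickleK_inv -/rho bx by0 subr0 gtr0_norm//; lra.
Qed.

End Aharoni.

(** * Separability of c_0 and C[0,1] *)

Section separable.
Variable R : realType.

Definition separable (X : normedModType R) :=
  exists e : nat -> X, forall x r, 0 < r -> exists i, `|x - e i| <= r.

(** One point picked from each nonempty piece, at every radius 2^-n, gives a dense sequence. Only a
    countable invariant locating a point up to r is then needed, not explicit dense elements. *)
Lemma separable_of_cover (I : countType) (X : normedModType R) :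
  (forall r : R, 0 < r -> exists P : I -> X -> Prop,
    (forall x, exists i, P i x) /\
    (forall i x y, P i x -> P i y -> `|x - y| <= r)) -> separable X.
Proof.
move=> H.
have /choice[P HP] : forall n : nat, exists P : I -> X -> Prop,
    (forall x, exists i, P i x) /\
    (forall i x y, P i x -> P i y -> `|x - y| <= 2 ^- n).
  by move=> n; apply: H; rewrite invr_gt0 exprn_gt0.
exists (fun m => if @pickle_inv (nat * I)%type m is Some (n, i)
                 then xget 0 [set x | P n i x] else 0) => x r r0.
have [n nr] := expr2V_le r0.
have [/(_ x)[i Pix] Pn] := HP n; exists (pickle (n, i)).
rewrite pickleK_inv; apply: le_trans nr; apply: (Pn i) => //.
exact: (@xgetI _ 0 [set x | P n i x] x).
Qed.

Lemma floor_div (e x : R) : 0 < e -> `|x - e * (Num.floor (x / e))%:~R| <= e.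
Proof.
move=> e0; have /andP[] := floor_itv (x / e).
rewrite ler_pdivlMr// ltr_pdivrMr// intrD mulrDl mul1r (mulrC _ e) => lo hi.
by rewrite ler_norml; apply/andP; lra.
Qed.

(** The invariant is the list of coordinates rounded to multiples of r / 2; the default 0 of [nth]
    serves the tail, where the coordinates are small. *)
Lemma c0_separable : separable (c0 R).
Proof.
apply: (@separable_of_cover (seq int)) => r r0.
exists (fun ks (u : c0 R) => forall n, `|u n - r / 2 * (nth 0 ks n)%:~R| <= r / 2).
split=> [u|ks u v Hu Hv].
  have e0 : 0 < r / 2 by rewrite divr_gt0.
  have [N HN] := c0_cvg u e0.
  exists (mkseq (fun n => Num.floor (u n / (r / 2))) N) => n.
  have [nN|nN] := ltnP n N; first by rewrite nth_mkseq//; exact: floor_div.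
  by rewrite nth_default ?size_mkseq// mulr0 subr0 HN.
apply: c0_norm_le => n; rewrite c0_subE.
have := Hu n; have := Hv n; rewrite !ler_norml => /andP[? ?] /andP[? ?].
by apply/andP; lra.
Qed.

(** Phrased for functions on the whole line, so that it covers both elements of [C01] extended by 0
    and the continuous functions that approximate elements of L_r. *)
Definition continuous_on01 (g : R -> R) :=
  forall x : R, 0 <= x <= 1 -> forall e : R, 0 < e -> exists2 d : R, 0 < d &
    forall t : R, 0 <= t <= 1 -> `|t - x| < d -> `|g t - g x| <= e.

Lemma unit_interval_uniform (g : R -> R) : continuous_on01 g ->
  forall e : R, 0 < e -> exists N : nat, forall s t : R, 0 <= s <= 1 -> 0 <= t <= 1 ->
    `|s - t| <= N.+1%:R^-1 -> `|g s - g t| <= e.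
Proof.
move=> cg e e0.
have /compact_near_coveringP := @segment_compact R 0 1.
have cov (x : R) : `[0, 1]%classic x -> \forall s \near x & N \near \oo,
    0 <= s <= 1 -> forall t : R, 0 <= t <= 1 ->
    `|s - t| <= N.+1%:R^-1 -> `|g s - g t| <= e.
  move=> /=; rewrite in_itv/= => x01.
  have [d d0 Hd] := cg x x01 (e / 2) (divr_gt0 e0 (ltr0Sn _ 1)).
  have [n nd] := expr2V_le (divr_gt0 d0 (ltr0Sn R 3)).
  exists (ball x (d / 2), [set N | (2 ^ n <= N)%N]) => /=.
    split; first by apply: nbhsx_ballx; rewrite divr_gt0.
    by exists (2 ^ n)%N.
  move=> [s N] /= [xs nN] s01 t t01 st.
  have xs' : `|s - x| < d / 2 by rewrite distrC.
  have Nd : N.+1%:R^-1 <= d / 4 :> R.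
    apply: le_trans nd; rewrite lef_pV2 ?posrE ?exprn_gt0//.
    by rewrite -natrX ler_nat ltnW.
  have tx : `|t - x| < d.
    have := le_trans st Nd.
    have := ler_distD s t x; rewrite (distrC t s); lra.
  have := Hd t t01 tx; have : `|g s - g x| <= e / 2 by apply: Hd => //; lra.
  have := ler_distD (g x) (g s) (g t); rewrite (distrC (g x) (g t)); lra.
move=> /(_ nat \oo _ _ cov) [N _ HN]; exists N => s t s01 t01 st.
by apply: (HN N _ s) => //=; rewrite in_itv.
Qed.

Definition step (e : R) (c : nat * seq int) (t : R) : R :=
  e * (nth 0 c.2 (Num.truncn (t * c.1.+1%:R)))%:~R.

Lemma step_approximation (g : R -> R) : continuous_on01 g ->
  forall e : R, 0 < e -> exists c, forall t : R, 0 <= t <= 1 ->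
    `|g t - step e c t| <= 2 * e.
Proof.
move=> cg e e0; have [N HN] := unit_interval_uniform cg e0.
(* The end point t = 1 has index N + 1, hence N + 2 values for N + 1 intervals. *)
exists (N, mkseq (fun i => Num.floor (g (i%:R / N.+1%:R) / e)) N.+2) => t t01.
have N0 : 0 < N.+1%:R :> R by [].
rewrite /step/=; set i := Num.truncn _.
have /andP[ti it] : i%:R <= t * N.+1%:R < i.+1%:R.
  by apply: truncn_itv; rewrite mulr_ge0// (andP t01).1.
have iN : (i < N.+2)%N.
  rewrite ltnS -(ler_nat R); apply: le_trans ti _.
  by rewrite ler_piMl// (andP t01).2.
rewrite nth_mkseq//.
have s01 : 0 <= (i%:R / N.+1%:R : R) <= 1.
  by rewrite divr_ge0//= ler_pdivrMr// mul1r ler_nat.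
have st : `|t - i%:R / N.+1%:R| <= N.+1%:R^-1.
  rewrite ger0_norm ?subr_ge0 ?ler_pdivrMr//.
  by rewrite lerBlDl -[X in _ + X]mul1r -mulrDl ler_pdivlMr// natr1 ltW.
have := HN _ _ t01 s01 st.
have := floor_div (g (i%:R / N.+1%:R)) e0.
set G := g (i%:R / _).
have := ler_distD G (g t) (e * (Num.floor (G / e))%:~R); lra.
Qed.

Local Notation I01 := (set_type (`[0, 1]%classic : set R)).

Lemma continuous01P (f : I01 -> R) : continuous f <->
  forall x (e : R), 0 < e -> exists2 d : R, 0 < d &
    forall t, `|val t - val x| < d -> `|f t - f x| <= e.
Proof.
split=> [cf x e e0|H x].
  have /cvgrPdist_le/(_ e e0)/nbhs_ballP[d /= d0 Hd] := cf x.
  exists d => // t tx; rewrite distrC; apply: Hd.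
  by change (`|val x - val t| < d); rewrite distrC.
apply/(@cvgrPdist_le _ _ _ _ (nbhs_filter x)) => e e0.
have [d d0 Hd] := H x e e0.
have vx : nbhs x (val @^-1` ball (val x) d).
  exact: (@initial_continuous I01 R val x _ (nbhsx_ballx (val x) d d0)).
apply: (@filterS _ (nbhs x) (nbhs_filter x) _ _ _ vx) => t xt.
by rewrite distrC; apply: Hd; rewrite distrC.
Qed.

Definition extend01 (f : I01 -> R) (t : R) : R :=
  if insub t is Some x then f x else 0.

Lemma extend01E (f : I01 -> R) x : extend01 f (val x) = f x.
Proof. by rewrite /extend01 valK. Qed.

Lemma C01_separable : separable (C01 R).
Proof.
apply: (@separable_of_cover (nat * seq int)%type) => r r0.
have e0 : 0 < r / 4 by rewrite divr_gt0.
exists (fun c (f : C01 R) =>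
  forall x, `|f x - step (r / 4) c (val x)| <= 2 * (r / 4)).
split=> [f|c f g Hf Hg].
  have /step_approximation/(_ _ e0)[c Hc] : continuous_on01 (extend01 f).
    move=> x x01 e1 e10; case: f => f /= /asboolP /continuous01P cf.
    have inI (t : R) : 0 <= t <= 1 -> t \in `[0, 1]%classic by rewrite inE/= in_itv.
    have [d d0 Hd] := cf (exist _ x (inI x x01)) e1 e10.
    have extE t (t01 : 0 <= t <= 1) : extend01 f t = f (exist _ t (inI t t01)).
      exact: (extend01E f (exist _ t (inI t t01))).
    exists d => // t t01 tx; rewrite (extE t t01) (extE x x01); exact: Hd.
  exists c => x; rewrite -extend01E; apply: Hc.
  by have := set_valP x; rewrite /= in_itv.
rewrite C01_normE.
have z01 : (0 : R) \in `[0, 1]%classic by rewrite inE/= in_itv/= lexx ler01.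
apply: (supnorm_le (exist _ 0 z01)) => x.
have -> : (f - g) x = f x - g x by [].
have := Hf x; have := Hg x; rewrite !ler_norml => /andP[? ?] /andP[? ?].
by apply/andP; lra.
Qed.

End separable.

(** * Reductions to c_0 *)

Section powR_inequalities.
Variable R : realType.
Implicit Types a b p q : R.

(** For u in [0, 1] one has u <= u^p; this is applied to a / (a + b) and b / (a + b). It makes the
    power [a] <= 1 of a norm distance a metric again. *)
Lemma powR_subadd a b p : 0 <= a -> 0 <= b -> 0 < p <= 1 ->
  (a + b) `^ p <= a `^ p + b `^ p.
Proof.
move=> a0 b0 /andP[p0 p1].
have [s0|s0] := eqVneq (a + b) 0.
  by rewrite s0 powR0 ?gt_eqF// addr_ge0 ?powR_ge0.
have {}s0 : 0 < a + b by rewrite lt_neqAle eq_sym s0 addr_ge0.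
have part x : 0 <= x -> x <= a + b -> x / (a + b) * (a + b) `^ p <= x `^ p.
  move=> x0 xs; have [->|xn0] := eqVneq x 0; first by rewrite !mul0r powR_ge0.
  rewrite -[in leRHS](divfK (lt0r_neq0 s0) x) powRM ?divr_ge0 ?(ltW s0)//.
  rewrite ler_wpM2r ?powR_ge0// ger1_powR//.
  rewrite ler_pdivrMr// mul1r xs andbT divr_gt0//.
  by rewrite lt_neqAle eq_sym xn0.
apply: le_trans (lerD (part a a0 _) (part b b0 _)); rewrite ?lerDl ?lerDr//.
by rewrite -mulrDl -mulrDl divff ?mul1r// lt0r_neq0.
Qed.

Lemma powR_quasi_triangle a b q : 0 <= a -> 0 <= b -> 0 <= q ->
  (a + b) `^ q <= 2 `^ q * (a `^ q + b `^ q).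
Proof.
move=> a0 b0 q0; wlog ab : a b a0 b0 / b <= a => [H|].
  have [ba|/ltW ab] := leP b a; first exact: H.
  by rewrite addrC [X in _ * X]addrC; exact: H.
apply: (@le_trans _ _ ((2 * a) `^ q)).
  by rewrite ge0_ler_powR// ?nnegrE ?addr_ge0 ?mulr_ge0// mulr_natl lerD2l.
by rewrite powRM// ler_wpM2l ?powR_ge0// lerDl powR_ge0.
Qed.

Lemma powR_le_mono a b p : 0 < p -> 0 <= a -> a <= b -> a `^ p <= b `^ p.
Proof.
move=> p0 a0 ab; apply: ge0_ler_powR; rewrite ?nnegrE ?(le_trans a0 ab)//.
exact: ltW.
Qed.

Lemma powR_le_cancel a b p : 0 < p -> 0 <= b -> a `^ p <= b `^ p -> a <= b.
Proof.
move=> p0 b0; rewrite [a <= b]leNgt; apply: contraTN => ba.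
by rewrite -ltNge gt0_ltr_powR// nnegrE// ltW// (le_lt_trans b0).
Qed.

End powR_inequalities.

Section embeddings.
Variable R : realType.

Lemma Holder_continuous (X Y : normedModType R) (p q C : R) (f : X -> Y) :
  0 < p -> 0 < q ->
  (forall x y, `|f x - f y| `^ q <= C * `|x - y| `^ p) -> continuous f.
Proof.
move=> p0 q0 H x; apply/cvgrPdist_le => e e0.
have C1 : 0 < `|C| + 1 by rewrite ltr_wpDl.
(* The solution of (|C| + 1) d^p = e^q. *)
pose d := (e `^ q / (`|C| + 1)) `^ p^-1.
have d0 : 0 < d by rewrite powR_gt0// divr_gt0// powR_gt0.
apply/nbhs_ballP; exists d => //= y; rewrite -ball_normE/= => xy.
apply: (powR_le_cancel q0 (ltW e0)); apply: le_trans (H x y) _.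
have xyd : `|x - y| `^ p <= d `^ p by rewrite powR_le_mono// ltW.
apply: (@le_trans _ _ ((`|C| + 1) * d `^ p)).
  apply: le_trans (_ : `|C| * `|x - y| `^ p <= _).
    by rewrite ler_wpM2r ?powR_ge0// ler_norm.
  by rewrite ler_pM ?powR_ge0// lerDl.
rewrite /d -powRrM mulVf ?gt_eqF// powRr1 ?divr_ge0 ?powR_ge0 ?(ltW C1)//.
by rewrite mulrC divfK// gt_eqF.
Qed.

Lemma E_reducible_embedding (X Y : normedModType R) (p q c C : R)
    (f : X -> Y) : 0 < p -> 0 < q -> 0 < c ->
  (forall x y, c * `|x - y| `^ p <= `|f x - f y| `^ q) ->
  (forall x y, `|f x - f y| `^ q <= C * `|x - y| `^ p) ->
  borel_reducible (E X p) (E Y q).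
Proof.
move=> p0 q0 c0 lo up; have cf := Holder_continuous p0 q0 up.
exact: reducible_of_embedding c0 cf lo up.
Qed.

Lemma E_reducible_c0 (X : normedModType R) (p q : R) :
  separable X -> 0 < p -> p <= q -> borel_reducible (E X p) (E (c0 R) q).
Proof.
move=> [e He] p0 pq; have q0 := lt_le_trans p0 pq.
pose a := p / q.
have a0 : 0 < a by rewrite divr_gt0.
have a1 : a <= 1 by rewrite ler_pdivrMr// mul1r.
have aq : a * q = p by rewrite divfK// gt_eqF.
pose d (x y : X) := `|x - y| `^ a.
have [||||f Hf] := @Aharoni R X d e.
- by move=> x y; exact: powR_ge0.
- by move=> x y; rewrite /d distrC.
- move=> x y z; rewrite /d.
  apply: le_trans (powR_subadd (normr_ge0 _) (normr_ge0 _) _).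
    by rewrite powR_le_mono// ler_distD.
  by rewrite a0 a1.
- move=> x r r0; have [|i xi] := He x (r `^ a^-1); first exact: powR_gt0.
  exists i; apply: le_trans (powR_le_mono a0 (normr_ge0 _) xi) _.
  by rewrite -powRrM mulVf ?gt_eqF// powRr1// ltW.
(* The distortion 10 comes from [Aharoni]; q-th powers of its two bounds involve the p-th power of
   the norm because a q = p. *)
apply: (@E_reducible_embedding _ _ p q (10 `^ - q) 1 f) => //.
- move=> x y; have /andP[+ _] := Hf x y.
  move=> /(powR_le_mono q0 (divr_ge0 (powR_ge0 _ _) (ler0n _ _))).
  by rewrite powRM ?powR_ge0 ?invr_ge0// -powRrM aq mulrC -powR_inv1// -powRrM mulN1r.
- move=> x y; have /andP[_] := Hf x y.
  by move=> /(powR_le_mono q0 (normr_ge0 _)); rewrite -powRrM aq mul1r.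
Qed.

End embeddings.

(** * c_0 inside C[0,1] *)

Section c0_in_C01.
Variable R : realType.

(** A bump with peak 1 at 2^-n, nonzero only for 3/4 < 2^n t < 5/4; these windows are disjoint for
    different n because 5/4 < 2 (3/4). *)
Definition tent (n : nat) (t : R) : R := Num.max 0 (1 - 4 * `|2 ^+ n * t - 1|).

Lemma tent_ge0 n t : 0 <= tent n t.
Proof. by rewrite /tent le_max lexx. Qed.

Lemma tent_le1 n t : tent n t <= 1.
Proof. by rewrite /tent ge_max ler01/= gerBl mulr_ge0. Qed.

Lemma tent_peak n : tent n (2 ^- n) = 1.
Proof.
rewrite /tent divff ?expf_neq0 ?pnatr_eq0// subrr normr0 mulr0 subr0.
exact/max_r/ler01.
Qed.

Lemma tent_neq0 n t : tent n t != 0 -> 3 / 4 < 2 ^+ n * t < 5 / 4.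
Proof.
rewrite /tent; set y := _ * t => yn0.
have : 0 < 1 - 4 * `|y - 1|.
  by rewrite ltNge; apply: contraNN yn0 => /max_l ->.
have := ler_norm (y - 1); have := ler_norm (- (y - 1)); rewrite normrN; lra.
Qed.

Lemma tent_disjoint n m t : tent n t != 0 -> tent m t != 0 -> n = m.
Proof.
wlog nm : n m / (n <= m)%N => [H|].
  by have [nm|/ltnW nm] := leqP n m => *; [|symmetry]; exact: H nm _ _.
move: nm; rewrite leq_eqVlt => /predU1P[->//|nm].
move=> /tent_neq0 /andP[lo _] /tent_neq0 /andP[_ hi].
have contra (y z : R) : y <= z -> 3 / 4 < y -> 2 * z < 5 / 4 -> False by lra.
case: (contra (2 ^+ n * t) (2 ^+ (m - n.+1) * (2 ^+ n * t))) => //.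
  rewrite ler_peMl ?exprn_ege1 ?ler1n//.
  by apply: ltW; apply: lt_trans lo; rewrite divr_gt0.
suff -> : 2 * (2 ^+ (m - n.+1) * (2 ^+ n * t)) = 2 ^+ m * t by [].
by rewrite -[in RHS](subnK nm) addnS exprS exprD !mulrA.
Qed.

Lemma tent_Lipschitz n s t : `|tent n s - tent n t| <= 4 * 2 ^+ n * `|s - t|.
Proof.
have H a b : Num.max 0 a - Num.max 0 b <= `|a - b| :> R.
  have := ler_norm (a - b); have := normr_ge0 (a - b).
  by case: (leP 0 a); case: (leP 0 b); lra.
have {}H a b : `|Num.max 0 a - Num.max 0 b| <= `|a - b| :> R.
  by rewrite ler_norml lerNl opprB H distrC H.
apply: le_trans (H _ _) _.
have -> : 1 - 4 * `|2 ^+ n * s - 1| - (1 - 4 * `|2 ^+ n * t - 1|) =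
          4 * (`|2 ^+ n * t - 1| - `|2 ^+ n * s - 1|) by ring.
rewrite normrM ger0_norm// -mulrA ler_pM2l//.
apply: le_trans (ler_dist_dist _ _) _.
by rewrite opprB addrA subrK -mulrBr normrM ger0_norm ?exprn_ge0// distrC.
Qed.

(** The sum of all u n times [tent n t], which has at most one nonzero term. When there is none, the
    default index 0 still gives the value 0. *)
Definition tent_series (u : nat -> R) (t : R) : R :=
  let n := xget 0%N [set n | tent n t != 0] in u n * tent n t.

Lemma tent_seriesE u n t : tent n t != 0 -> tent_series u t = u n * tent n t.
Proof.
move=> nt; rewrite /tent_series; case: xgetP => [m _ /= mt|/(_ n)/(_ nt)//].
by rewrite (tent_disjoint nt mt).
Qed.

Lemma tent_series_eq0 u t : (forall n, tent n t = 0) -> tent_series u t = 0.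
Proof. by move=> t0; rewrite /tent_series t0 mulr0. Qed.

(** The remainder has at most one nonzero term at t. The estimate is uniform in t, so continuity
    passes from the Lipschitz partial sums to the series. *)
Lemma tent_series_partial u N e t : 0 <= e ->
  (forall n, (N <= n)%N -> `|u n| <= e) ->
  `|tent_series u t - \sum_(n < N) u n * tent n t| <= e.
Proof.
move=> e0 uN; have [[n nt]|t0] := pselect (exists n, tent n t != 0); last first.
  have {}t0 n : tent n t = 0.
    by apply/eqP; apply: contra_notT t0 => nt; exists n.
  rewrite tent_series_eq0// big1 ?subr0 ?normr0// => i _.
  by rewrite t0 mulr0.
have other i : i != n -> u i * tent i t = 0.
  move=> ni; suff -> : tent i t = 0 by rewrite mulr0.
  apply/eqP; apply: contra_neqT ni => it; exact: tent_disjoint it nt.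
rewrite (tent_seriesE u nt); have [nN|nN] := ltnP n N.
  rewrite (bigD1 (Ordinal nN))//= big1 ?addr0 ?subrr ?normr0// => i ni.
  by apply: other; apply: contra_neq ni => E; exact: val_inj.
rewrite big1 ?subr0 => [|i _]; last first.
  by apply: other; rewrite ltn_eqF// (leq_trans _ nN).
rewrite normrM (ger0_norm (tent_ge0 _ _)).
by rewrite (le_trans (ler_piMr _ (tent_le1 _ _))) ?uN.
Qed.

Local Notation I01 := (set_type (`[0, 1]%classic : set R)).

Lemma tent_series_continuous (u : c0 R) :
  (fun x : I01 => tent_series u (val x)) \in @continuous01 R.
Proof.
apply/asboolP/continuous01P => x e e0.
have e3 : 0 < e / 3 by rewrite divr_gt0.
have [N HN] := c0_cvg u e3.
pose L := \sum_(n < N) `|u n| * (4 * 2 ^+ n).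
have L0 : 0 <= L.
  by apply: sumr_ge0 => n _; rewrite !mulr_ge0// exprn_ge0.
have L1 : 0 < L + 1 by rewrite ltr_wpDl.
exists (e / 3 / (L + 1)) => [|t tx]; first by rewrite divr_gt0.
have := tent_series_partial (val t) (ltW e3) HN.
have := tent_series_partial (val x) (ltW e3) HN.
set Sx := \sum_(n < N) _; set St := \sum_(n < N) _.
have : `|St - Sx| <= e / 3.
  apply: (@le_trans _ _ (L * `|val t - val x|)).
    rewrite /St /Sx -sumrB /L mulr_suml.
    apply: le_trans (ler_norm_sum _ _ _) _; apply: ler_sum => n _.
    by rewrite -mulrBr normrM -mulrA ler_wpM2l ?tent_Lipschitz.
  rewrite -[leRHS](divfK (lt0r_neq0 L1)) mulrC.
  by apply: ler_pM => //; [exact: ltW|rewrite lerDl].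
rewrite !ler_norml => /andP[? ?] /andP[? ?] /andP[? ?]; apply/andP; lra.
Qed.

(** The active index at a point does not depend on the sequence, so two series differ there by one
    coordinate difference times a number in [0, 1]; the peaks 2^-n recover every coordinate. *)
Theorem C01_contains_c0 : exists f : c0 R -> C01 R,
  forall u v, `|f u - f v| = `|u - v|.
Proof.
exists (fun u => MkC01 (tent_series_continuous u)) => u v.
have z01 : (0 : R) \in `[0, 1]%classic by rewrite inE/= in_itv/= lexx ler01.
apply/le_anti/andP; split.
  rewrite C01_normE; apply: (supnorm_le (exist _ 0 z01)) => x.
  have -> : (MkC01 (tent_series_continuous u) - MkC01 (tent_series_continuous v))
    x = tent_series u (val x) - tent_series v (val x) by [].
  rewrite /tent_series; set n := xget _ _; rewrite -mulrBl normrM.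
  rewrite (ger0_norm (tent_ge0 _ _)) (le_trans (ler_piMr _ (tent_le1 _ _)))//.
  by rewrite -c0_subE c0_norm_ge.
apply: c0_norm_le => n; rewrite c0_subE.
have n01 : (2 ^- n : R) \in `[0, 1]%classic.
  rewrite inE/= in_itv/= invr_ge0 exprn_ge0//= invf_le1 ?exprn_gt0//.
  by rewrite exprn_ege1// ler1n.
have pk : tent n (2 ^- n) != 0 by rewrite tent_peak oner_neq0.
have -> : u n - v n =
  (MkC01 (tent_series_continuous u) - MkC01 (tent_series_continuous v))
    (exist _ (2 ^- n) n01).
  change (u n - v n = tent_series u (2 ^- n) - tent_series v (2 ^- n)).
  by rewrite !(tent_seriesE _ pk) tent_peak !mulr1.
by rewrite C01_normE; apply: le_supnorm; exact: C01_bounded.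
Qed.

Lemma E_reducible_c0_C01 (p : R) : 0 < p ->
  borel_reducible (E (c0 R) p) (E (C01 R) p).
Proof.
move=> p0; have [f Hf] := C01_contains_c0.
by apply: (@E_reducible_embedding _ _ _ p p 1 1 f) => // x y; rewrite mul1r Hf.
Qed.

End c0_in_C01.

(** * Baire category on sequences *)

Section infinite_words.
Variable A : Type.
Implicit Types (s t w : seq A) (x y : nat -> A).

(** Concatenation of a finite word with an infinite one: the default argument of [nth] supplies the
    tail. *)
Definition wcat s x : nat -> A := fun n => nth (x (n - size s)%N) s n.
Definition shift m x : nat -> A := fun n => x (m + n)%N.
Definition agree n x y := forall i, (i < n)%N -> x i = y i.

Lemma wcat0 x : wcat [::] x = x.
Proof. by apply/funext => n; rewrite /wcat nth_nil subn0. Qed.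

Lemma wcat_lt a0 s x n : (n < size s)%N -> wcat s x n = nth a0 s n.
Proof. by move=> ns; rewrite /wcat; exact: set_nth_default. Qed.

Lemma wcat_ge s x n : (size s <= n)%N -> wcat s x n = x (n - size s)%N.
Proof. by move=> ns; rewrite /wcat nth_default. Qed.

Lemma wcat_cat s t x : wcat (s ++ t) x = wcat s (wcat t x).
Proof.
apply/funext => n; have [ns|ns] := ltnP n (size s).
  by rewrite !(wcat_lt (x 0%N)) ?size_cat ?ltn_addr// nth_cat ns.
rewrite [RHS]wcat_ge// /wcat nth_cat ltnNge ns/= size_cat subnDA.
by [].
Qed.

Lemma shift_wcat s x : shift (size s) (wcat s x) = x.
Proof. by apply/funext => n; rewrite /shift wcat_ge ?leq_addr// addKn. Qed.

Lemma shiftD m n x : shift m (shift n x) = shift (n + m) x.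
Proof. by apply/funext => i; rewrite /shift addnA. Qed.

Lemma wcat_shift n x : wcat (mkseq x n) (shift n x) = x.
Proof.
apply/funext => i; have [ni|ni] := ltnP i n.
  by rewrite (wcat_lt (x 0%N)) ?size_mkseq// nth_mkseq.
by rewrite wcat_ge size_mkseq// /shift subnKC.
Qed.

Lemma shift_wcat_lt m s x : (m <= size s)%N ->
  shift m (wcat s x) = wcat (drop m s) x.
Proof.
move=> ms; rewrite -{1}(cat_take_drop m s) wcat_cat.
by rewrite -{1}(size_takel ms) shift_wcat.
Qed.

Lemma shift_wcat_ge m s x : (size s <= m)%N ->
  shift m (wcat s x) = shift (m - size s) x.
Proof. by move=> sm; rewrite -{1}(subnKC sm) -shiftD shift_wcat. Qed.

Lemma agree_shift n x y : agree n x y -> y = wcat (mkseq x n) (shift n y).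
Proof.
move=> xy; rewrite -{1}(wcat_shift n y); congr wcat.
by apply/eq_in_map => i; rewrite mem_iota/= => ni; rewrite xy.
Qed.

Lemma agree_wcat s n x y : agree n (wcat s x) (wcat (s ++ mkseq x n) y).
Proof.
move=> i ni; rewrite wcat_cat; have [si|si] := ltnP i (size s).
  by rewrite !(wcat_lt (x 0%N)).
have ni' : (i - size s < n)%N by rewrite (leq_ltn_trans (leq_subr _ _)).
by rewrite !(@wcat_ge s)// (wcat_lt (x 0%N)) ?size_mkseq// nth_mkseq.
Qed.

Lemma agree_le m n x y : (m <= n)%N -> agree n x y -> agree m x y.
Proof. by move=> mn xy i im; apply: xy; exact: leq_trans mn. Qed.

Variable a0 : A.

Definition pieces (V : nat -> seq A) n := flatten (map V (iota 0 n)).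
(** Infinite concatenation of the words V n. When all of them are nonempty, the first n + 1 already
    cover position n. *)
Definition wlim (V : nat -> seq A) : nat -> A := fun n => nth a0 (pieces V n.+1) n.

Lemma piecesS V n : pieces V n.+1 = V 0%N ++ pieces (fun i => V i.+1) n.
Proof. by rewrite /pieces/= -[1%N]addn0 iotaDl -map_comp. Qed.

Lemma piecesSr V n : pieces V n.+1 = pieces V n ++ V n.
Proof.
by rewrite /pieces -{1}addn1 iotaD map_cat flatten_cat /= cats0.
Qed.

Section positive_pieces.
Variable V : nat -> seq A.
Hypothesis V0 : forall n, (0 < size (V n))%N.

Lemma size_pieces n : (n <= size (pieces V n))%N.
Proof.
elim: n => // n IH; rewrite piecesSr size_cat -addn1; exact: leq_add.
Qed.

Lemma nth_pieces m n i : (i < m)%N -> (m <= n)%N ->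
  nth a0 (pieces V n) i = nth a0 (pieces V m) i.
Proof.
move=> im; elim: n => [|n IH]; first by rewrite leqn0 => /eqP ->.
rewrite leq_eqVlt => /predU1P[->//|]; rewrite ltnS => mn.
rewrite piecesSr nth_cat ifT ?IH//.
by rewrite (leq_trans im)// (leq_trans mn)// size_pieces.
Qed.

End positive_pieces.

Lemma wlimS V : (forall n, (0 < size (V n))%N) ->
  wlim V = wcat (V 0%N) (wlim (fun n => V n.+1)).
Proof.
move=> V0; apply/funext => n; rewrite /wlim piecesS nth_cat.
case: ltnP => [nV|nV]; first by rewrite (wcat_lt a0).
rewrite wcat_ge//; apply: nth_pieces => //.
by rewrite ltn_subrL V0 (leq_trans (V0 0%N)).
Qed.

Lemma wlim_pieces V n : (forall n, (0 < size (V n))%N) ->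
  wlim V = wcat (pieces V n) (wlim (fun i => V (n + i)%N)).
Proof.
elim: n V => [|n IH] V V0; first by rewrite wcat0.
rewrite wlimS// piecesS wcat_cat (IH (fun i => V i.+1))//.
Qed.

End infinite_words.

Section Baire_category.
Variables (A : Type) (a0 : A).

(* [dopen D]: the set [D] contains a dense open set of the product topology. *)
Definition dopen (D : set (nat -> A)) :=
  forall s, exists w, forall x, D (wcat (s ++ w) x).

(** Words forcing D 0, D 1, ... are appended in turn to s; the extra letter [a0] at each stage makes
    the lengths grow, so that an infinite word results. *)
Theorem Baire_words (D : nat -> set (nat -> A)) : (forall n, dopen (D n)) ->
  forall s, exists x, forall n, D n (wcat s x).
Proof.
move=> dD s.
have /choice[e He] : forall n, exists e : seq A -> seq A,
    forall s x, D n (wcat (s ++ e s) x).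
  move=> n; have /choice[f Hf] := dD n; by exists f.
pose W := fix W n := if n is m.+1 then W m ++ e m (W m) ++ [:: a0] else s.
pose V n := e n (W n) ++ [:: a0].
have V0 n : (0 < size (V n))%N by rewrite size_cat addn1.
have WV n : W n = s ++ pieces V n.
  elim: n => [|n IH]; first by rewrite cats0.
  by rewrite piecesSr catA -IH.
exists (wlim a0 V) => n; rewrite (wlim_pieces a0 n.+1 V0) -wcat_cat -WV/= catA.
by rewrite wcat_cat; exact: He.
Qed.

End Baire_category.

(** * Sets with the Baire property *)

Section Baire_property.
Variables (A : Type) (a0 : A).
Local Notation sT := (nat -> A).

(** Openness in the product of discrete copies of [A]. *)
Definition cylinder_open (U : set sT) :=
  forall x, U x -> exists n, forall y, agree n x y -> U y.

Definition Baire_property (B : set sT) := exists (U : set sT) (D : nat -> set sT),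
  [/\ cylinder_open U, forall n, dopen (D n) &
      forall x, (forall n, D n x) -> (B x <-> U x)].

Lemma dopenT : dopen [set: sT].
Proof. by move=> s; exists [::]. Qed.

Lemma Baire_property_open U : cylinder_open U -> Baire_property U.
Proof.
by move=> oU; exists U, (fun=> setT); split => // n; exact: dopenT.
Qed.

(** The complement of U is replaced by its interior V. Only the boundary of U is lost: the dense
    open set U [|] V joins the family as its member of index 0. *)
Lemma Baire_property_setC B : Baire_property B -> Baire_property (~` B).
Proof.
move=> [U [D [oU dD BU]]].
pose V := [set x | exists n, forall y, agree n x y -> ~ U y].
have oV : cylinder_open V.
  move=> x [n Hn]; exists n => y xy; exists n => z yz; apply: Hn => i ni.
  by rewrite xy// yz.
exists V, (fun n => if n is m.+1 then D m else U `|` V); split => //.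
  case=> [|n]; last exact: dD.
  move=> s; have [[x Ux]|nU] := pselect (exists x, U (wcat s x)).
    have [n Hn] := oU _ Ux; exists (mkseq x n) => y; left; apply: Hn.
    exact: agree_wcat.
  exists [::] => x; right; exists (size s) => y sy Uy; apply: nU.
  exists (shift (size s) y); suff <- : y = wcat s (shift (size s) y) by [].
  rewrite {1}(agree_shift sy); congr wcat.
  apply: (@eq_from_nth _ a0) => [|i]; rewrite size_mkseq// => si.
  by rewrite nth_mkseq// cats0 (wcat_lt a0).
move=> x Dx; have {}BU := BU x (fun n => Dx n.+1).
split=> [nB|[n Hn] Bx]; last by apply: (Hn x) => //; exact/BU.
by case: (Dx 0%N) => //= Ux; exfalso; exact/nB/BU.
Qed.

Lemma Baire_property_bigcup (B : nat -> set sT) :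
  (forall n, Baire_property (B n)) -> Baire_property (\bigcup_n B n).
Proof.
move=> /choice[U] /choice[D H].
exists (\bigcup_n U n),
  (fun k => if @pickle_inv (nat * nat)%type k is Some (n, m) then D n m else setT).
split.
- move=> x [n _ Unx]; have [oU _ _] := H n; have [m Hm] := oU x Unx.
  by exists m => y xy; exists n => //; exact: Hm.
- by move=> k; case: pickle_inv => [[n m]|]; [case: (H n)|exact: dopenT].
- move=> x Dx; have BU n : B n x <-> U n x.
    have [_ _] := H n; apply => m.
    by have := Dx (pickle (n, m)); rewrite pickleK_inv.
  by split=> -[n _ /BU]; exists n.
Qed.

Lemma sigma_algebra_Baire_property : sigma_algebra [set: sT] Baire_property.
Proof.
split.
- by apply: Baire_property_open => x [].
- by move=> B BB; rewrite setTD; exact: Baire_property_setC.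
- exact: Baire_property_bigcup.
Qed.

End Baire_property.

Section tail_sets.
Variables (A : countType) (a0 : A).
Local Notation sT := (nat -> A).

Lemma countable_dopen (I : countType) (D : I -> set sT) :
  (forall i, dopen (D i)) ->
  exists2 D' : nat -> set sT, forall n, dopen (D' n) &
    forall x, (forall n, D' n x) <-> (forall i, D i x).
Proof.
move=> dD.
exists (fun n => if @pickle_inv I n is Some i then D i else setT).
  by move=> n; case: pickle_inv => [i|]; [exact: dD|exact: dopenT].
move=> x; split=> [H i|H n]; last by case: pickle_inv.
by have := H (pickle i); rewrite pickleK_inv.
Qed.

(** The family is enlarged by its preimages under all maps that replace the first m letters by a
    word t. These maps are closed under composition with changes of prefix, which makes the
    intersection invariant. *)
Lemma tail_dopen (D : nat -> set sT) : (forall n, dopen (D n)) ->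
  exists D' : nat -> set sT, [/\ forall n, dopen (D' n),
    forall x, (forall n, D' n x) -> (forall n, D n x) &
    forall s x, (forall n, D' n (wcat s x)) <-> (forall n, D' n x)].
Proof.
move=> dD; pose D1 (i : seq A * nat * nat) :=
  [set x | D i.2 (wcat i.1.1 (shift i.1.2 x))].
have dD1 i : dopen (D1 i).
  (* Padding s with m letters guarantees that dropping m letters removes only part of the finite
     word. *)
  case: i => -[t m] n s; have [w Hw] := dD n (t ++ drop m (s ++ nseq m a0)).
  exists (nseq m a0 ++ w) => x; rewrite /D1/=.
  rewrite shift_wcat_lt; last first.
    by rewrite !size_cat size_nseq addnCA leq_addr.
  rewrite -wcat_cat catA drop_cat size_cat size_nseq.
  have [sm|sm] := ltnP m (size s + m); first by rewrite catA; exact: Hw.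
  have /eqP s0 : size s == 0%N by rewrite -leqn0 -(leq_add2r m).
  move: Hw; rewrite s0 add0n subnn drop0 drop_oversize ?cats0//.
  by rewrite size_cat size_nseq s0.
have [D' dD' D'P] := countable_dopen dD1.
exists D'; split => // [x /D'P H n|s x].
  by have := H ([::], 0%N, n); rewrite /D1/= wcat0.
rewrite !D'P; split=> H [[t m] n]; rewrite /D1/=.
  have := H (t, (size s + m)%N, n).
  by rewrite /D1/= -shiftD shift_wcat.
have [ms|sm] := leqP m (size s).
  rewrite shift_wcat_lt// -wcat_cat.
  by have := H (t ++ drop m s, 0%N, n).
by rewrite shift_wcat_ge ?(ltnW sm)//; have := H (t, (m - size s)%N, n).
Qed.

End tail_sets.

(** * Block decomposition *)

Section power_distance.
Variables (R : realType) (Y : normedModType R) (q : R).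
Hypothesis q0 : 0 < q.
Implicit Types f g h : nat -> Y.

(** The q-th power of the l_q distance on one block of coordinates; additive over blocks, but the
    triangle inequality holds only up to a factor 2^q. *)
Definition pdist (m n : nat) f g : R := \sum_(m <= k < n) `|f k - g k| `^ q.

Lemma pdist_ge0 m n f g : 0 <= pdist m n f g.
Proof. by apply: sumr_ge0 => k _; exact: powR_ge0. Qed.

Lemma pdistC m n f g : pdist m n f g = pdist m n g f.
Proof. by apply: eq_bigr => k _; rewrite distrC. Qed.

Lemma pdistxx m n f : pdist m n f f = 0.
Proof.
by rewrite /pdist big1// => k _; rewrite subrr normr0 powR0 ?gt_eqF.
Qed.

Lemma pdist_triangle m n f g h :
  pdist m n f h <= 2 `^ q * (pdist m n f g + pdist m n g h).
Proof.
rewrite /pdist -big_split mulr_sumr; apply: ler_sum => k _.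
apply: le_trans (powR_quasi_triangle _ _ (ltW q0)) => //.
by rewrite powR_le_mono// ler_distD.
Qed.

Lemma pdist_widen m n m' n' f g : (m' <= m)%N -> (n <= n')%N ->
  pdist m n f g <= pdist m' n' f g.
Proof.
move=> mm nn; have [mn|nm] := leqP m n; last first.
  by rewrite {1}/pdist big_geq ?pdist_ge0// ltnW.
rewrite /pdist [leRHS](big_cat_nat (n := m))//=; last exact: leq_trans nn.
rewrite [X in _ <= _ + X](big_cat_nat (n := n))//=.
rewrite addrCA lerDl addr_ge0// sumr_ge0// => k _; exact: powR_ge0.
Qed.

End power_distance.

Lemma bddsum_tail (R : realType) (a : nat -> R) (e : R) :
  (forall i, 0 <= a i) -> bddsum a -> 0 < e ->
  exists K, forall M, \sum_(K <= i < M) a i <= e.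
Proof.
move=> a0 [B aB] e0; pose S := [set \sum_(0 <= i < n) a i | n in [set: nat]].
have supS : has_sup S.
  split; first by exists (\sum_(0 <= i < 0) a i); exists 0%N.
  by exists B => _ [n _ <-]; rewrite big_mkord.
have [_ [K _ <-] SK] := sup_adherent e0 supS; exists K => M.
have [KM|/ltnW MK] := leqP K M; last by rewrite big_geq// ltW.
have : \sum_(0 <= i < M) a i <= sup S.
  by apply: sup_upper_bound => //; exists M.
rewrite (big_cat_nat (n := K))//=; lra.
Qed.

Lemma dense_all (A : Type) (B : eqType) (Q : B -> seq A -> Prop) (l : seq B) :
  (forall b w w', Q b w -> Q b (w ++ w')) ->
  (forall b, b \in l -> forall w, exists w', Q b (w ++ w')) ->
  forall w, exists w', forall b, b \in l -> Q b (w ++ w').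
Proof.
move=> mono; elim: l => [|b l IH] H w; first by exists [::].
have [w1 H1] := H b (mem_head _ _) w.
have [|w2 H2] := IH _ (w ++ w1).
  by move=> c cl; apply: H; rewrite inE cl orbT.
exists (w1 ++ w2) => c; rewrite inE catA => /predU1P[->|cl].
  exact: mono.
exact: H2.
Qed.

Lemma uniform_bound (B : eqType) (P : B -> nat -> Prop) (l : seq B) :
  (forall b m n, (m <= n)%N -> P b m -> P b n) ->
  (forall b, b \in l -> exists n, P b n) ->
  exists n, forall b, b \in l -> P b n.
Proof.
move=> mono; elim: l => [|b l IH] H; first by exists 0%N.
have [m Pm] := H b (mem_head _ _).
have [|n Pn] := IH; first by move=> d dl; apply: H; rewrite inE dl orbT.
exists (maxn m n) => d; rewrite inE => /predU1P[->|/Pn].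
  by apply: mono Pm; exact: leq_maxl.
by apply: mono; exact: leq_maxr.
Qed.

Section block_decomposition.
Variables (R : realType) (Y : normedModType R) (q : R).
Variables (A : eqType) (a0 : A) (D : nat -> set (nat -> A)).
(** In the application T is the reduction applied to decoded words and [G] a comeager tail set on
    which it is continuous; [T_finite] expresses that words with a common tail at the same place are
    equivalent. *)
Variable T : (nat -> A) -> nat -> Y.
Let G x := forall n, D n x.
Hypothesis q1 : 1 <= q.
Hypothesis dD : forall n, dopen (D n).
Hypothesis G_tail : forall s x, G (wcat s x) <-> G x.
Hypothesis T_continuous : forall x, G x -> forall k (e : R), 0 < e ->
  exists n, forall y, G y -> agree n x y -> `|T x k - T y k| <= e.
Hypothesis T_finite : forall s t, size s = size t -> forall x,
  bddsum (fun k => `|T (wcat s x) k - T (wcat t x) k| `^ q).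

Let q0 : 0 < q := lt_le_trans ltr01 q1.
Let c : R := 2 `^ q.
Let c1 : 1 <= c.
Proof. by rewrite -(powRr0 2) ler_powR// ?ler1n// ltW. Qed.
Local Notation pdist := (@pdist R Y q).

Let T_pdist_continuous x M e : G x -> 0 < e -> exists n, forall y, G y ->
  agree n x y -> pdist 0 M (T x) (T y) <= e.
Proof.
move=> Gx; elim: M e => [|M IH] e e0.
  by exists 0%N => y _ _; rewrite /pdist big_geq// ltW.
have e20 : 0 < e / 2 by rewrite divr_gt0.
have [n Hn] := IH _ e20.
have [m Hm] := T_continuous Gx M (powR_gt0 q^-1 e20).
exists (maxn n m) => y Gy xy; rewrite /pdist big_nat_recr//=.
have := Hn y Gy (agree_le (leq_maxl _ _) xy).
have := powR_le_mono q0 (normr_ge0 _) (Hm y Gy (agree_le (leq_maxr _ _) xy)).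
rewrite -powRrM mulVf ?gt_eqF// powRr1 ?(ltW e20)// /pdist; lra.
Qed.

Let tail_small e (st : seq A * seq A) w := exists K, forall x, G x ->
  forall M, pdist K M (T (wcat (st.1 ++ w) x)) (T (wcat (st.2 ++ w) x)) <= e.

Let tail_small_mono e st w w' : tail_small e st w -> tail_small e st (w ++ w').
Proof.
move=> [K HK]; exists K => x Gx M.
by rewrite !catA !(wcat_cat (_ ++ w)); apply: HK; exact/G_tail.
Qed.

(** By contradiction: otherwise, for each K, continuity on [G] makes it dense open relative to [G]
    that the two prefixes differ by more than a fixed amount beyond K. A word generic for all K
    violates [T_finite]. *)
Let tail_small_dense e st w : 0 < e -> size st.1 = size st.2 ->
  exists w', tail_small e st (w ++ w').
Proof.
move: st => [s t]/= e0 sz; apply: contrapT => /forallNP H.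
have {}H w' K : exists x, G x /\ exists M,
    e < pdist K M (T (wcat (s ++ w ++ w') x)) (T (wcat (t ++ w ++ w') x)).
  apply: contrapT => N; apply: (H w'); exists K => x Gx M /=.
  by rewrite leNgt; apply/negP => eM; apply: N; exists x; split => //; exists M.
(* Two uses of the quasi-triangle inequality turn three errors e1 into at most 3 c^2 e1, which is
   less than e. *)
pose e1 := e / (4 * c ^+ 2).
have c0 : 0 < c := lt_le_trans ltr01 c1.
have e10 : 0 < e1 by rewrite divr_gt0// mulr_gt0// exprn_gt0.
pose O K := [set y | G y -> exists M,
  e1 < pdist K M (T (wcat (s ++ w) y)) (T (wcat (t ++ w) y))].
have dO K : dopen (O K).
  move=> u; have [x [Gx [M eM]]] := H u K.
  have near r : exists n, forall m y, (n <= m)%N -> G y -> pdist 0 M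
      (T (wcat (r ++ w ++ u) x)) (T (wcat (r ++ w ++ u ++ mkseq x m) y)) <= e1.
    have [|n Hn] := @T_pdist_continuous (wcat (r ++ w ++ u) x) M e1 _ e10.
      exact/G_tail.
    exists n => m y nm Gy; rewrite !catA -catA; apply: Hn; first exact/G_tail.
    by rewrite -!catA !catA; apply: (agree_le nm); exact: agree_wcat.
  have [[n1 near_s] [n2 near_t]] := (near s, near t).
  pose n := maxn n1 n2; exists (mkseq x n) => y Gy.
  have {}Gy : G y by move: Gy => /G_tail.
  exists M; rewrite ltNge; apply/negP => le1.
  have := near_s n y (leq_maxl _ _) Gy; have := near_t n y (leq_maxr _ _) Gy.
  move: le1 eM; rewrite -!wcat_cat -!catA.
  set fs := T _; set ft := T _; set gs := T _; set gt := T _ => le1 eM ht hs.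
  have tri : pdist K M gs gt <= c * (e1 + c * (e1 + e1)).
    apply: le_trans (pdist_triangle q0 K M gs fs gt) _; rewrite ler_pM2l//.
    apply: lerD; first exact: le_trans (pdist_widen q _ _ _ _) hs.
    apply: le_trans (pdist_triangle q0 K M fs ft gt) _; rewrite ler_pM2l//.
    by apply: lerD => //; rewrite pdistC; exact: le_trans (pdist_widen q _ _ _ _) ht.
  have := lt_le_trans eM tri.
  have -> : e = 4 * (c * (c * e1)) by rewrite /e1; field; rewrite gt_eqF.
  have ba : c * e1 <= c * (c * e1) by rewrite ler_pM2l// ler_peMl// ltW.
  have a_gt0 : 0 < c * (c * e1) by apply: mulr_gt0 => //; apply: mulr_gt0.
  have lin (a b : R) : 0 < a -> b <= a -> 4 * a < b + (a + a) -> False by lra.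
  by rewrite !mulrDr; exact: lin a_gt0 ba.
(* Even indices put y into [G], odd indices into every [O K]. *)
have [y Hy] := Baire_words a0 (D := fun n => if odd n then O n./2 else D n./2)
  (fun n => if odd n as b return dopen (if b then O n./2 else D n./2)
            then dO _ else dD _) [::].
have Gy : G y.
  by move=> n; have := Hy n.*2; rewrite odd_double doubleK wcat0.
have szw : size (s ++ w) = size (t ++ w) by rewrite !size_cat sz.
have [K HK] := bddsum_tail (fun k => powR_ge0 _ _) (T_finite szw y) e10.
have := Hy K.*2.+1; rewrite /= odd_double/= uphalf_double wcat0 => /(_ Gy)[M].
by rewrite ltNge HK.
Qed.

Let prefix_stable e K s w := forall x y, G x -> G y ->
  pdist 0 K (T (wcat (s ++ w) x)) (T (wcat (s ++ w) y)) <= e.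

Let prefix_stable_mono e K s w w' :
  prefix_stable e K s w -> prefix_stable e K s (w ++ w').
Proof.
move=> H x y Gx Gy; rewrite !catA !(wcat_cat (_ ++ w)).
by apply: H; exact/G_tail.
Qed.

(** Continuity at a single generic continuation y: once a long prefix of y has been appended, all
    generic continuations are close to it on the first K coordinates. *)
Let prefix_stable_dense e K s w : 0 < e -> exists w', prefix_stable e K s (w ++ w').
Proof.
move=> e0; have [y Hy] := Baire_words a0 dD [::].
have c0 : 0 < c := lt_le_trans ltr01 c1.
have Gy : G y by move=> n; have := Hy n; rewrite wcat0.
pose e1 := e / (2 * c).
have e10 : 0 < e1 by rewrite divr_gt0// mulr_gt0.
have [|n Hn] := @T_pdist_continuous (wcat (s ++ w) y) K e1 _ e10.
  exact/G_tail.
have near x : G x -> pdist 0 K (T (wcat (s ++ w) y))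
    (T (wcat (s ++ w ++ mkseq y n) x)) <= e1.
  move=> Gx; apply: Hn; first exact/G_tail.
  by rewrite catA; exact: agree_wcat.
exists (mkseq y n) => x x' Gx Gx'.
apply: le_trans (pdist_triangle q0 0 K _ (T (wcat (s ++ w) y)) _) _.
have -> : e = 2 `^ q * (e1 + e1) by rewrite /e1 -/c; field; rewrite gt_eqF.
by rewrite ler_pM2l// lerD ?near// pdistC near.
Qed.

Let generic n s w := forall x, D n (wcat (s ++ w) x).

Let generic_mono n s w w' : generic n s w -> generic n s (w ++ w').
Proof. by move=> H x; rewrite catA wcat_cat; exact: H. Qed.

Let generic_dense n s w : exists w', generic n s (w ++ w').
Proof.
by have [w' Hw'] := dD n (s ++ w); exists w' => x; rewrite catA; exact: Hw'.
Qed.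

(** The order matters: w1 yields the coordinate beyond which the prefixes in S are interchangeable,
    and only then can w2 freeze the coordinates before it; w3 forces D n. Each property survives the
    later extensions. *)
Lemma stage (S : seq (seq A)) (e : R) (n K0 : nat) : 0 < e ->
  (forall s t, s \in S -> t \in S -> size s = size t) ->
  exists wK : seq A * nat, [/\ (K0 < wK.2)%N,
    forall s t, s \in S -> t \in S -> forall x, G x -> forall M,
      pdist wK.2 M (T (wcat (s ++ wK.1) x)) (T (wcat (t ++ wK.1) x)) <= e,
    forall s, s \in S -> forall x y, G x -> G y ->
      pdist 0 wK.2 (T (wcat (s ++ wK.1) x)) (T (wcat (s ++ wK.1) y)) <= e &
    forall s, s \in S -> forall x, D n (wcat (s ++ wK.1) x)].
Proof.
move=> e0 szS.
have [|st|w1 H1] := @dense_all _ _ (tail_small e)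
    [seq (s, t) | s <- S, t <- S] _ _ [::].
- by move=> st w w'; exact: tail_small_mono.
- move=> /allpairsP[[s t]/= [sS tS ->]] w; apply: tail_small_dense => //.
  exact: szS.
have {H1} [K HK] := @uniform_bound _ (fun st K => forall x, G x -> forall M,
    pdist K M (T (wcat (st.1 ++ w1) x)) (T (wcat (st.2 ++ w1) x)) <= e)
  [seq (s, t) | s <- S, t <- S]
  (fun st m n mn H x Gx M => le_trans (pdist_widen q _ _ mn (leqnn M)) (H x Gx M))
  H1.
pose K1 := maxn K K0.+1.
have [|s|w2 H2] := @dense_all _ _ (prefix_stable e K1) S _ _ w1.
- by move=> s w w'; exact: prefix_stable_mono.
- by move=> sS w; exact: prefix_stable_dense.
have [|s|w3 H3] := @dense_all _ _ (generic n) S _ _ (w1 ++ w2).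
- by move=> s w w'; exact: generic_mono.
- by move=> sS w; exact: generic_dense.
exists ((w1 ++ w2) ++ w3, K1); split => /=; first exact: leq_maxr.
- move=> s t sS tS x Gx M.
  apply: le_trans (pdist_widen q _ _ (leq_maxl K K0.+1) (leqnn M)) _.
  rewrite -catA !catA -!(catA (_ ++ w1)) !(wcat_cat (_ ++ w1)).
  apply: (HK (s, t)); last exact/G_tail.
  by apply/allpairsP; exists (s, t).
- by move=> s sS; apply: prefix_stable_mono; exact: H2.
- by move=> s sS; exact: H3.
Qed.

Variables (F : nat -> seq A) (b : nat -> A).
Hypothesis Fb : forall j, b j \in F j.

Definition weave (w : nat -> seq A) (x : nat -> A) := wlim a0 (fun j => x j :: w j).

(** Beyond K j the choices made before j hardly matter, and before K (j + 1) those made after j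
    hardly matter. So [psi j] may be read off from the sequence with the given letter at place j and
    b elsewhere. *)
Theorem block_decomposition : exists (w : nat -> seq A) (K : nat -> nat)
    (psi : nat -> A -> nat -> Y),
  [/\ K 0%N = 0%N, forall j, (K j < K j.+1)%N &
      forall x, (forall j, x j \in F j) -> G (weave w x) /\ forall j,
        pdist (K j) (K j.+1) (T (weave w x)) (psi j (x j)) <= 2 * c * 2 ^- j].
Proof.
(* [T_finite] compares only prefixes of equal length; this is maintained along the construction, and
   the value of [st] is arbitrary otherwise. *)
pose same (S : seq (seq A)) := forall s t, s \in S -> t \in S -> size s = size t.
have e0 n : 0 < 2 ^- n :> R by rewrite invr_gt0 exprn_gt0.
have /choice[st Hst] : forall a : seq (seq A) * nat * nat, exists wK : seq A * nat,
    same a.1.1 -> [/\ (a.2 < wK.2)%N,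
    forall s t, s \in a.1.1 -> t \in a.1.1 -> forall x, G x -> forall M,
      pdist wK.2 M (T (wcat (s ++ wK.1) x)) (T (wcat (t ++ wK.1) x)) <= 2 ^- a.1.2.+1,
    forall s, s \in a.1.1 -> forall x y, G x -> G y ->
      pdist 0 wK.2 (T (wcat (s ++ wK.1) x)) (T (wcat (s ++ wK.1) y)) <= 2 ^- a.1.2.+1 &
    forall s, s \in a.1.1 -> forall x, D a.1.2 (wcat (s ++ wK.1) x)].
  move=> [[S n] K0]; have [Ssame|nS] := pselect (same S).
    by have [wK HwK] := stage n K0 (e0 n.+1) Ssame; exists wK.
  by exists ([::], 0%N).
pose ext (S : seq (seq A)) n := [seq rcons s a | s <- S, a <- F n].
pose next (SK : seq (seq A) * nat) n := st (ext SK.1 n, n, SK.2).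
(* First component: all prefixes woven from choices in the first n sets F; second component: the cut
   K n. *)
pose SK := fix SK n := if n is m.+1 then
  ([seq s ++ (next (SK m) m).1 | s <- ext (SK m).1 m], (next (SK m) m).2)
  else ([:: [::]], 0%N).
pose w n := (next (SK n) n).1; pose K n := (SK n).2.
have ext_same S n : same S -> same (ext S n).
  move=> Ss _ _ /allpairsP[[s a]/= [sS _ ->]] /allpairsP[[t d]/= [tS _ ->]].
  by rewrite !size_rcons (Ss s t).
have SKsame n : same (SK n).1.
  elim: n => [s t|n IH s t] /=; first by rewrite !inE => /eqP -> /eqP ->.
  move=> /mapP[s' s'S ->] /mapP[t' t'S ->]; rewrite !size_cat; congr (_ + _)%N.
  exact: ext_same s'S t'S.
have H n := Hst (ext (SK n).1 n, n, (SK n).2) (ext_same _ n (SKsame n)).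
have Ha n s t : s \in (SK n).1 -> t \in (SK n).1 -> forall x, G x -> forall M,
    pdist (K n) M (T (wcat s x)) (T (wcat t x)) <= 2 ^- n.
  case: n => [|n] /=.
    rewrite !inE => /eqP -> /eqP -> x _ M.
    by rewrite pdistxx// expr0 invr1 ler01.
  have [_ Ha _ _] := H n.
  by move=> /mapP[s' s'S ->] /mapP[t' t'S ->]; exact: Ha.
have Hb n s : s \in (SK n).1 -> forall x y, G x -> G y ->
    pdist 0 (K n) (T (wcat s x)) (T (wcat s y)) <= 2 ^- n.
  case: n => [|n] /=.
    by move=> _ x y _ _; rewrite /pdist big_geq// expr0 invr1 ler01.
  by have [_ _ Hb _] := H n; move=> /mapP[s' s'S ->]; exact: Hb.
have Hc n s : s \in (SK n.+1).1 -> forall x, D n (wcat s x).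
  by have [_ _ _ Hc] := H n; move=> /mapP[s' s'S ->]; exact: Hc.
pose V x j : seq A := x j :: w j.
have V0 x j : (0 < size (V x j))%N by [].
have piecesSK x n : (forall j, x j \in F j) -> pieces (V x) n \in (SK n).1.
  move=> xF; elim: n => [|n IH]; first by rewrite inE.
  rewrite piecesSr; apply/mapP; exists (rcons (pieces (V x) n) (x n)).
    by apply/allpairsP; exists (pieces (V x) n, x n); split => //=; exact: xF.
  by rewrite cat_rcons.
have weaveE x n : weave w x = wcat (pieces (V x) n) (wlim a0 (fun i => V x (n + i)%N)).
  exact: wlim_pieces (V0 x).
have Gweave x : (forall j, x j \in F j) -> G (weave w x).
  by move=> xF n; rewrite (weaveE x n.+1); apply: Hc; exact: piecesSK.
exists w, K, (fun j a => T (weave w (fun i => if i == j then a else b i))).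
split=> // [j|x xF]; first by have [] := H j.
split=> [|j]; first exact: Gweave.
pose y i := if i == j then x j else b i.
have yF i : y i \in F i by rewrite /y; case: eqP => // ->.
pose tl z n := wlim a0 (fun i => V z (n + i)%N).
have Gtl z n : (forall j, z j \in F j) -> G (tl z n).
  by move=> zF; have := Gweave z zF; rewrite (weaveE z n) => /G_tail.
(* The hybrid word with the past of y and the future of x. From x to it only the past of j changes,
   from it to y only the future, because x and y share the letter at j. *)
have mid : wcat (pieces (V y) j) (tl x j) = wcat (pieces (V y) j.+1) (tl x j.+1).
  rewrite piecesSr wcat_cat /tl wlimS => [|n]; last exact: V0.
  have -> : V y j = V x j by rewrite /V /y eqxx.
  rewrite addn0; congr (wcat _ (wcat _ (wlim _ _))).
  by apply/funext => i; rewrite addnS.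
apply: le_trans (pdist_triangle q0 _ _ _ (T (wcat (pieces (V y) j) (tl x j))) _) _.
rewrite -/c mulrAC [leRHS]mulrC ler_pM2l; last exact: lt_le_trans ltr01 c1.
have -> : 2 * 2 ^- j = 2 ^- j + 2 ^- j :> R by rewrite mulr_natl mulr2n.
apply: lerD.
  by rewrite (weaveE x j); apply: Ha; [exact: piecesSK|exact: piecesSK|exact: Gtl].
apply: (@le_trans _ _ (2 ^- j.+1)); last first.
  by rewrite lef_pV2 ?posrE ?exprn_gt0// ler_eXn2l// ltr1n.
rewrite mid -/(weave w y) (weaveE y j.+1).
apply: le_trans (pdist_widen q _ _ (leq0n _) (leqnn _)) _.
by apply: Hb; [exact: piecesSK|exact: Gtl|exact: Gtl].
Qed.

End block_decomposition.

(** * Additive form of a reduction *)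

Section additive_reduction.
Variables (R : realType) (X Y : normedModType R) (p q : R).
Variables (A : countType) (a0 : A) (dec : A -> X).
Hypotheses (p1 : 1 <= p) (q1 : 1 <= q).
Let p0 : 0 < p := lt_le_trans ltr01 p1.
Let q0 : 0 < q := lt_le_trans ltr01 q1.

Let decode (x : nat -> A) : {ptws nat -> X} := fun n => dec (x n).

(** Words agreeing with x on longer and longer prefixes decode to sequences converging pointwise to
    [decode x], so they cannot all avoid O. *)
Lemma decode_cylinder_open (O : set {ptws nat -> X}) :
  open O -> cylinder_open (decode @^-1` O).
Proof.
move=> oO x Ox; apply: contrapT => /forallNP H.
have /choice[y Hy] : forall n, exists y, agree n x y /\ ~ O (decode y).
  move=> n; have /existsNP[y /not_implyP[xy nO]] := H n.
  by exists y.
have ycvg : (fun n => decode (y n)) @ \oo --> decode x.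
  apply: (proj2 (@pointwise_cvgP nat X _ (decode x) (fmap_filter _ _))) => t /=.
  apply: cvg_near_cst; exists t.+1 => // n /= tn.
  by rewrite /decode (proj1 (Hy n)).
have [N _ HN] : \forall n \near \oo, O (decode (y n)).
  by apply: ycvg; exact: open_nbhs_nbhs.
by have [_] := Hy N; apply; exact: HN (leqnn N).
Qed.

Lemma eval_ball_open (k : nat) (c : Y) (r : R) :
  open [set y : {ptws nat -> Y} | `|y k - c| < r].
Proof.
have -> : [set y : {ptws nat -> Y} | `|y k - c| < r] =
    (fun y : {ptws nat -> Y} => y k) @^-1` (ball c r).
  by apply/seteqP; split => y /=; rewrite -ball_normE/= distrC.
move: (ball c r) (@ball_open _ _ c r) => B oB.
apply: (@open_comp {ptws nat -> Y} Y (fun y => y k)).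
  by move=> y _; exact: (@proj_continuous nat (fun=> Y) k y).
exact: oB.
Qed.

Lemma bddsum_finite_support (a : nat -> R) N : (forall i, 0 <= a i) ->
  (forall i, (N <= i)%N -> a i = 0) -> bddsum a.
Proof.
move=> a_ge0 aN; exists (\sum_(i < N) a i) => n.
have [nN|/ltnW Nn] := leqP n N; first exact: (ler_sum_prefix a_ge0 nN).
rewrite -!(big_mkord xpredT) [leLHS](big_cat_nat (n := N))//=.
rewrite [X in _ + X <= _](_ : _ = 0) ?addr0//.
by rewrite big_nat_cond big1// => i /andP[/andP[/aN]].
Qed.

Lemma sum_wcat (d : A -> A -> R) (s t : seq A) u v n : size s = size t ->
  \sum_(i < size s + n) d (wcat s u i) (wcat t v i) =
  \sum_(i < size s) d (nth a0 s i) (nth a0 t i) + \sum_(i < n) d (u i) (v i).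
Proof.
move=> st; rewrite big_split_ord/=; congr (_ + _); apply: eq_bigr => i _ /=.
  by rewrite !(wcat_lt a0) -?st.
by rewrite !wcat_ge -?st ?leq_addr// addKn.
Qed.

Lemma sum_weave (d : A -> A -> R) (w : nat -> seq A) x y j :
  (forall a, d a a = 0) ->
  \sum_(i < size (pieces (fun j => x j :: w j) j)) d (weave a0 w x i) (weave a0 w y i) =
  \sum_(i < j) d (x i) (y i).
Proof.
move=> d0; elim: j w x y => [|j IH] w x y; first by rewrite !big_ord0.
rewrite piecesS size_cat /weave (@wlimS _ a0 (fun j => x j :: w j))//.
rewrite (@wlimS _ a0 (fun j => y j :: w j))// sum_wcat// big_ord_recl/=.
rewrite [X in _ + X + _]big1 ?addr0; last by move=> i _; rewrite d0.
rewrite big_ord_recl/=; congr (_ + _).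
exact: (IH (fun i => w i.+1) (fun i => x i.+1) (fun i => y i.+1)).
Qed.

(** Both weaves contain the same filler words at the same places, so only the entries x j and y j
    contribute; partial sums are compared at the ends of the pieces. *)
Lemma bddsum_weave (w : nat -> seq A) x y :
  E X p (decode (weave a0 w x)) (decode (weave a0 w y)) <->
  bddsum (fun j => `|dec (x j) - dec (y j)| `^ p).
Proof.
rewrite E_bddsum.
pose d a b := `|dec a - dec b| `^ p.
have dxx a : d a a = 0 by rewrite /d subrr normr0 powR0// gt_eqF.
rewrite (@bddsum_subseq _ _ (fun j => size (pieces (fun j => x j :: w j) j))).
- split=> -[M HM]; exists M => j; have := HM j.
    by rewrite (sum_weave w x y j dxx).
  by rewrite (sum_weave w x y j dxx).
- by move=> i; exact: powR_ge0.
- by move=> j; exact: size_pieces.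
Qed.

Lemma bddsum_blocks (K : nat -> nat) (f g : nat -> Y) : K 0%N = 0%N ->
  (forall j, (K j < K j.+1)%N) ->
  bddsum (fun k => `|f k - g k| `^ q) <->
  bddsum (fun j => pdist q (K j) (K j.+1) f g).
Proof.
move=> K0 KS; rewrite (@bddsum_subseq _ _ K); last 2 first.
- by move=> i; exact: powR_ge0.
- by elim=> // j IH; exact: leq_ltn_trans (KS j).
have E j : \sum_(i < K j) `|f i - g i| `^ q =
    \sum_(i < j) pdist q (K i) (K i.+1) f g.
  elim: j => [|j IH]; first by rewrite K0 !big_ord0.
  rewrite big_ord_recr/= -IH -!(big_mkord xpredT (fun i => `|f i - g i| `^ q)).
  by rewrite (big_cat_nat (n := K j))//= ltnW.
by split=> -[M HM]; exists M => j; have := HM j; rewrite E.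
Qed.

Variables (F : nat -> seq A) (b : nat -> A).
Hypothesis Fb : forall j, b j \in F j.

Theorem additive_reduction : separable Y ->
  borel_reducible (E X p) (E Y q) ->
  exists (K : nat -> nat) (psi : nat -> A -> nat -> Y),
    forall x y, (forall j, x j \in F j) -> (forall j, y j \in F j) ->
      bddsum (fun j => `|dec (x j) - dec (y j)| `^ p) <->
      bddsum (fun j => pdist q (K j) (K j.+1) (psi j (x j)) (psi j (y j))).
Proof.
move=> [e He] [theta Btheta Htheta].
pose T x : nat -> Y := theta (decode x).
(* Balls of radius 2^-l about the dense points, in each coordinate, are countably many. Where all
   their preimages agree with open sets, T is continuous. *)
have BP (i : nat * nat * nat) :
    Baire_property [set x | `|T x i.1.1 - e i.2| < 2 ^- i.1.2].
  have := @borel_set_preimage _ _ decode _ (sigma_algebra_Baire_property a0).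
  move=> /(_ (fun O oO => Baire_property_open (decode_cylinder_open oO))).
  move=> /(_ (theta @^-1` [set y : {ptws nat -> Y} | `|y i.1.1 - e i.2| < 2 ^- i.1.2])).
  apply; apply: Btheta; apply: sub_sigma_algebra; exact: eval_ball_open.
have /choice[U /choice[D0 HUD]] := BP.
have [D1 dD1 D1P] := @countable_dopen _ (nat * nat * nat * nat)%type
  (fun i => D0 i.1 i.2) (fun i => let: And3 _ H _ := HUD i.1 in H i.2).
have [D [dD DD1 Dtail]] := tail_dopen a0 dD1.
have T_cont x : (forall n, D n x) -> forall k (r : R), 0 < r ->
    exists n, forall y, (forall n, D n y) -> agree n x y -> `|T x k - T y k| <= r.
  move=> Dx k r r0.
  have [l lr] := expr2V_le (divr_gt0 r0 (ltr0Sn R 1)).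
  have l0 : 0 < 2 ^- l :> R by rewrite invr_gt0 exprn_gt0.
  have [i Ti] := He (T x k) (2 ^- l / 2) (divr_gt0 l0 (ltr0Sn R 1)).
  have [oU _ BU] := HUD (k, l, i).
  have near z : (forall n, D n z) -> (`|T z k - e i| < 2 ^- l) <-> U (k, l, i) z.
    by move=> /DD1/D1P Dz; apply: BU => m; exact: (Dz (k, l, i, m)).
  have {}Ti : `|T x k - e i| < 2 ^- l by apply: le_lt_trans Ti _; lra.
  have [n Hn] := oU x (proj1 (near x Dx) Ti).
  exists n => y Dy xy; have := proj2 (near y Dy) (Hn y xy).
  have := ler_distD (e i) (T x k) (T y k); rewrite (distrC (e i)).
  move: Ti lr; lra.
have T_fin s t : size s = size t -> forall x,
    bddsum (fun k => `|T (wcat s x) k - T (wcat t x) k| `^ q).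
  move=> st x; apply/E_bddsum/Htheta/E_bddsum.
  apply: (@bddsum_finite_support _ (size s)) => i; first exact: powR_ge0.
  by move=> si; rewrite /decode !wcat_ge -?st// subrr normr0 powR0// gt_eqF.
have [w [K [psi [K0 KS H]]]] :=
  @block_decomposition R Y q A a0 D T q1 dD Dtail T_cont T_fin F b Fb.
exists K, psi => x y xF yF; rewrite -(bddsum_weave w) Htheta E_bddsum.
rewrite (bddsum_blocks _ _ K0 KS) -/(T _) -/(T (weave a0 w y)).
have [_ Hx] := H x xF; have [_ Hy] := H y yF.
have err : bddsum (fun j => 2 * 2 `^ q * 2 ^- j : R).
  by apply: bddsumZ (bddsum_geometric R); rewrite mulr_ge0// powR_ge0.
have c0 : 0 <= 2 `^ q :> R by exact: powR_ge0.
(* Replacing both T-values by [psi] on each block costs two quasi-triangle inequalities and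
   geometric errors, so summability passes in both directions. *)
have perturb (u v : nat -> R) : (forall j, u j <= 2 `^ q *
      (2 * 2 `^ q * 2 ^- j + 2 `^ q * (v j + 2 * 2 `^ q * 2 ^- j))) ->
    bddsum v -> bddsum u.
  move=> uv bv; apply: bddsum_le uv _; apply: bddsumZ => //.
  by apply: bddsumD => //; apply: bddsumZ => //; exact: bddsumD.
have tri j f f' g g' e1 : pdist q (K j) (K j.+1) f f' <= e1 ->
    pdist q (K j) (K j.+1) g g' <= e1 -> pdist q (K j) (K j.+1) f g <=
    2 `^ q * (e1 + 2 `^ q * (pdist q (K j) (K j.+1) f' g' + e1)).
  move=> ff gg; apply: le_trans (pdist_triangle q0 _ _ f f' g) _.
  rewrite ler_wpM2l// lerD//.
  apply: le_trans (pdist_triangle q0 _ _ f' g' g) _.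
  by rewrite ler_wpM2l// lerD// pdistC.
by split; apply: perturb => j; apply: tri => //; rewrite pdistC.
Qed.

End additive_reduction.

(** * Extrapolation of Poincare inequalities *)

Section radial_map.
Variable R : realType.

(** Keeps the direction and raises the norm to the power a, so that s-th powers of norms become (a
    s)-th powers. *)
Definition radial (X : normedModType R) (a : R) (x : X) : X := `|x| `^ (a - 1) *: x.

Lemma radial_norm (X : normedModType R) a (x : X) : 0 < a ->
  `|radial a x| = `|x| `^ a.
Proof.
move=> a0; rewrite /radial normrZ ger0_norm ?powR_ge0// mulrC.
exact: mulr_powRB1.
Qed.

Lemma radialK (X : normedModType R) a (x : X) : 0 < a ->
  radial a^-1 (radial a x) = x.
Proof.
move=> a0; have [->|x0] := eqVneq x 0; first by rewrite /radial !scaler0.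
rewrite {1}/radial radial_norm// /radial scalerA -!powRrM -powRD; last first.
  by rewrite normr_eq0 x0 implybT.
by rewrite mulrBr divff ?gt_eqF// mulr1 subrKA subrr powRr0 scale1r.
Qed.

Lemma radial_close (a e : R) : 0 < a -> 0 < e < 1 -> exists2 d : R, 0 < d &
  forall (X : normedModType R) (x y : X), `|y| <= `|x| ->
  `|x - y| <= d * `|x| -> `|radial a x - radial a y| <= e * `|x| `^ a.
Proof.
move=> a0 /andP[e0 e1].
(* If |y| >= b |x|, then |y|^a >= (1 - e / 3) |x|^a. Below, the difference splits into a multiple of
   x - y, costing e / 3, and a multiple of y, costing 2 e / 3. *)
pose b := (1 - e / 3) `^ a^-1.
have e30 : 0 <= 1 - e / 3 by lra.
have b1 : b < 1.
  apply: (@lt_le_trans _ _ (1 `^ a^-1)); last by rewrite powR1.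
  by rewrite gt0_ltr_powR ?invr_gt0 ?nnegrE//; lra.
pose d := Num.min (e / 3) (1 - b).
have d0 : 0 < d by rewrite /d lt_min; apply/andP; split; lra.
exists d => // X x y yx xy.
have [x0|x0] := eqVneq x 0.
  have y0 : y = 0 by apply/eqP; rewrite -normr_le0 (le_trans yx)// x0 normr0.
  by rewrite x0 y0 subrr normr0 mulr_ge0 ?powR_ge0// ltW.
have u0 : 0 < `|x| by rewrite normr_gt0.
set u := `|x| in yx xy u0 *; set v := `|y| in yx *.
have ua : u * u `^ (a - 1) = u `^ a by exact: mulr_powRB1 (ltW u0) a0.
have ua0 : 0 <= u `^ (a - 1) by exact: powR_ge0.
have uv : u - v <= d * u.
  by apply: le_trans xy; apply: le_trans (ler_norm _) (ler_dist_dist _ _).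
have du : d * u <= e / 3 * u by rewrite ler_pM2r// /d ge_min lexx.
have vb : b * u <= v.
  have : d * u <= (1 - b) * u by rewrite ler_pM2r// /d ge_min lexx orbT.
  by rewrite mulrBl mul1r; lra.
have va : (1 - e / 3) * u `^ a <= v `^ a.
  have := powR_le_mono a0 (mulr_ge0 (powR_ge0 _ _) (ltW u0)) vb.
  rewrite powRM ?powR_ge0 ?(ltW u0)//.
  by rewrite /b -powRrM mulVf ?gt_eqF// powRr1.
have -> : radial a x - radial a y =
    u `^ (a - 1) *: (x - y) + (u `^ (a - 1) - v `^ (a - 1)) *: y.
  by rewrite /radial scalerBr scalerBl addrA subrK.
apply: le_trans (ler_normD _ _) _.
have -> : e * u `^ a = e / 3 * u `^ a + e * (2 / 3) * u `^ a by field.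
apply: lerD.
  rewrite normrZ ger0_norm// mulrC -ua mulrA ler_wpM2r//.
  exact: le_trans xy du.
have vv : v * v `^ (a - 1) = v `^ a by exact: mulr_powRB1 (normr_ge0 y) a0.
rewrite normrZ -/v -[X in _ * X](ger0_norm (normr_ge0 y)) -/v -normrM mulrBl.
rewrite ![_ `^ (a - 1) * v]mulrC vv.
have : u * u `^ (a - 1) - v * u `^ (a - 1) <= e / 3 * u `^ a.
  rewrite -mulrBl -ua mulrA ler_wpM2r//; exact: le_trans uv du.
have : v * u `^ (a - 1) <= u * u `^ (a - 1) by rewrite ler_wpM2r.
have : v `^ a <= u `^ a by exact: powR_le_mono a0 (normr_ge0 y) yx.
rewrite ua ler_norml => H1 H2 H3; apply/andP; split; lra.
Qed.

(* Close points are handled by [radial_close]; for the others the norms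
   themselves are controlled by [`|x - y|]. *)
Lemma radial_modulus (a s e : R) : 0 < a -> 0 < s -> 0 < e ->
  exists2 k : R, 0 <= k & forall (X : normedModType R) (x y : X),
  `|radial a x - radial a y| `^ s <=
  e * (`|x| `^ (a * s) + `|y| `^ (a * s)) + k * `|x - y| `^ (a * s).
Proof.
move=> a0 s0 e0; pose e1 := Num.min (2^-1) (e `^ s^-1).
have e10 : 0 < e1 by rewrite /e1 lt_min invr_gt0 ltr0n powR_gt0.
have e11 : e1 < 1 by rewrite /e1 gt_min; apply/orP; left; lra.
have e1e : e1 `^ s <= e.
  apply: (@le_trans _ _ ((e `^ s^-1) `^ s)).
    by rewrite powR_le_mono// ?(ltW e10)// /e1 ge_min lexx orbT.
  by rewrite -powRrM mulVf ?gt_eqF// powRr1// ltW.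
have [|d d0 Hd] := @radial_close a e1 a0; first by rewrite e10.
pose k := 2 `^ s * (d `^ (a * s))^-1.
have k0 : 0 <= k by rewrite mulr_ge0 ?invr_ge0 ?powR_ge0.
exists k => // X x y; wlog yx : x y / `|y| <= `|x|.
  have [yx|/ltW xy] := leP `|y| `|x| => H; first exact: H.
  by rewrite distrC (distrC x) (addrC (_ `^ _)); exact: H.
have [xy|xy] := leP `|x - y| (d * `|x|).
  apply: (@le_trans _ _ (e * `|x| `^ (a * s))).
    apply: le_trans (powR_le_mono s0 (normr_ge0 _) (Hd _ _ _ yx xy)) _.
    by rewrite powRM ?powR_ge0 ?(ltW e10)// -powRrM ler_wpM2r// powR_ge0.
  rewrite mulrDr -addrA lerDl addr_ge0// mulr_ge0 ?powR_ge0//; exact: ltW.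
apply: (@le_trans _ _ (k * `|x - y| `^ (a * s))); last first.
  by rewrite lerDr mulr_ge0 ?addr_ge0 ?powR_ge0// ltW.
have as0 : 0 < a * s by rewrite mulr_gt0.
apply: (@le_trans _ _ ((2 * `|x| `^ a) `^ s)).
  apply: powR_le_mono => //; apply: le_trans (ler_normB _ _) _.
  rewrite !radial_norm// mulr_natl mulr2n lerD2l; exact: powR_le_mono.
rewrite powRM ?powR_ge0// -powRrM /k -mulrA ler_wpM2l ?powR_ge0//.
rewrite ler_pdivlMl ?powR_gt0// -powRM ?(ltW d0)//.
by apply: powR_le_mono => //; [exact: mulr_ge0 (ltW d0) _|exact: ltW].
Qed.

End radial_map.

Section extrapolation.
Variable R : realType.

Definition bistochastic (V : finType) (w : V -> V -> R) :=
  [/\ forall x y, 0 <= w x y, forall x, \sum_y w x y = 1 & forall y, \sum_x w x y = 1].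

(** After division by the square of the number of points: the mean over all pairs is at most C times
    the mean over one step of the walk from a uniform start. *)
Definition poincare (X : normedModType R) (V : finType) (w : V -> V -> R) (s C : R) :=
  forall f : V -> X, \sum_x \sum_y `|f x - f y| `^ s <=
    C * #|V|%:R * \sum_x \sum_y w x y * `|f x - f y| `^ s.

Lemma exists_le_average (V : finType) (F : V -> R) : (0 < #|V|)%N ->
  exists x0, #|V|%:R * F x0 <= \sum_x F x.
Proof.
move=> /card_gt0P[v0 _].
have [x0 _ Hx] := @Order.TotalTheory.arg_minP _ _ _ v0 xpredT F isT.
exists x0; rewrite mulr_natl -sumr_const; apply: ler_sum => x _; exact: Hx.
Qed.

(* The inequality with exponent [s] is applied to [radial (t / s) \o g], where
   [g] is [f] translated so that the sum of the [`|g x| `^ t] is at most the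
   average of the double sum to be bounded; errors proportional to that sum are
   then absorbed. *)
Theorem poincare_extrapolation (s t C : R) : 0 < s -> 0 < t -> 0 <= C ->
  exists2 C' : R, 0 <= C' &
  forall (X : normedModType R) (V : finType) (w : V -> V -> R),
    bistochastic w -> poincare X w s C -> poincare X w t C'.
Proof.
move=> s0 t0 C0; pose a := t / s.
have a0 : 0 < a by rewrite divr_gt0.
have aV0 : 0 < a^-1 by rewrite invr_gt0.
have as_t : a * s = t by rewrite divfK// gt_eqF.
have at_s : a^-1 * t = s by rewrite -as_t mulKf// gt_eqF.
have [k k0 Hk] := @radial_modulus R a^-1 t 8^-1 aV0 t0 ltac:(by rewrite invr_gt0).
(* Makes k C e at most 1/8. The terms absorbed in the end are P / 4 twice, and the remaining half of
   P explains the factor 2 in the new constant. *)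
pose e := (8 * (k * C + 1))^-1.
have kC : 0 <= k * C by rewrite mulr_ge0.
have e0 : 0 < e by rewrite invr_gt0 mulr_gt0// ltr_wpDl.
have [k' k'0 Hk'] := @radial_modulus R a s e a0 s0 e0.
exists (2 * (k * k' * C)); first by rewrite !mulr_ge0.
move=> X V w [w0 wr wc] HP f.
have [V0|V0] := posnP #|V|.
  by rewrite !big1 ?mulr0// => x _; have := card0_eq V0 x.
set n := #|V|%:R; pose P := \sum_x \sum_y `|f x - f y| `^ t.
pose En := \sum_x \sum_y w x y * `|f x - f y| `^ t.
have n0 : 0 <= n by exact: ler0n.
have [x0 Hx0] := exists_le_average (fun y => \sum_x `|f x - f y| `^ t) V0.
rewrite exchange_big /= -/P in Hx0.
pose g x := f x - f x0; pose h x := radial a (g x).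
pose N := \sum_x `|g x| `^ t.
have nN : n * N <= P by [].
have gE x y : g x - g y = f x - f y by rewrite /g opprB addrA subrK.
have hg x : `|h x| `^ s = `|g x| `^ t by rewrite radial_norm// -powRrM as_t.
have sumC (F : V -> R) : \sum_(x : V) \sum_(y : V) F x = n * \sum_x F x.
  by rewrite mulr_sumr; apply: eq_bigr => x _; rewrite sumr_const mulr_natl.
have step1 : P <= 4^-1 * P + k * \sum_x \sum_y `|h x - h y| `^ s.
  apply: (@le_trans _ _ (\sum_x \sum_y (8^-1 * (`|g x| `^ t + `|g y| `^ t) +
      k * `|h x - h y| `^ s))).
    apply: ler_sum => x _; apply: ler_sum => y _.
    by have := Hk X (h x) (h y); rewrite !radialK// gE at_s !hg.
  under eq_bigr do rewrite big_split/= -!mulr_sumr big_split/=.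
  rewrite big_split/= -!mulr_sumr lerD2r big_split/= sumC exchange_big/= sumC.
  rewrite -/N; lra.
have step2 : \sum_x \sum_y w x y * `|h x - h y| `^ s <= 2 * e * N + k' * En.
  apply: (@le_trans _ _ (\sum_x \sum_y (e * (w x y * `|g x| `^ t) +
      e * (w x y * `|g y| `^ t) + k' * (w x y * `|f x - f y| `^ t)))).
    apply: ler_sum => x _; apply: ler_sum => y _.
    rewrite -mulrDr -mulrDr mulrCA (mulrCA k') -mulrDr ler_wpM2l//.
    by have := Hk' X (g x) (g y); rewrite gE as_t.
  under eq_bigr do rewrite !big_split -!mulr_sumr -mulr_suml wr mul1r/=.
  rewrite !big_split -!mulr_sumr/= -/N -/En [X in _ + e * X + _]exchange_big/=.
  under [X in _ + e * X + _]eq_bigr do rewrite -mulr_suml wc mul1r.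
  by rewrite -/N mulr2n mulrDl mul1r mulrDl.
have H := HP h.
have P0 : 0 <= P by apply: sumr_ge0 => x _; apply: sumr_ge0 => y _; exact: powR_ge0.
have kCe : k * C * e <= 8^-1.
  rewrite /e invfM mulrCA -[leRHS]mulr1 ler_pM2l//.
  by rewrite ler_pdivrMr ?mul1r ?lerDl// ltr_wpDl.
have step3 : P <= 4^-1 * P + k * (C * n * (2 * e * N + k' * En)).
  apply: le_trans step1 _; rewrite lerD2l ler_wpM2l//.
  by apply: le_trans H _; rewrite ler_wpM2l// mulr_ge0.
have step4 : k * C * e * (n * N) <= 8^-1 * P.
  apply: (@le_trans _ _ (k * C * e * P)); last exact: ler_wpM2r.
  by rewrite ler_wpM2l// !mulr_ge0// ltW.
move: step3 step4.
have -> : k * (C * n * (2 * e * N + k' * En)) =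
  2 * (k * C * e * (n * N)) + k * k' * C * n * En by ring.
have -> : 2 * (k * k' * C) * n * En = 2 * (k * k' * C * n * En) by ring.
move: (k * C * e * (n * N)) (k * k' * C * n * En) => u v.
rewrite -/P; lra.
Qed.

End extrapolation.

(** * The rank one walk on matrices *)

Section sign_characters.
Variable R : realType.

(** The nontrivial additive character of the field with two elements. *)
Definition sg2 (a : 'F_2) : R := if a == 0 then 1 else -1.

Lemma F2P (a : 'F_2) : a = 0 \/ a = 1.
Proof. by case: a => -[|[|[]]]//= i; [left|right]; exact/val_inj. Qed.

Lemma sg2D a b : sg2 (a + b) = sg2 a * sg2 b.
Proof.
by rewrite /sg2; case: (F2P a) => ->; case: (F2P b) => ->;
  rewrite ?addr0 ?add0r ?eqxx ?oner_eq0 ?mulr1 ?mul1r// mulrNN mulr1.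
Qed.

Lemma sg2N a : sg2 (- a) = sg2 a.
Proof. by rewrite /sg2 oppr_eq0. Qed.

Lemma sg2_sqr a : sg2 a * sg2 a = 1.
Proof. by rewrite /sg2; case: ifP; rewrite ?mulrNN mulr1. Qed.

Lemma sum_sg2_eq0 (W : finZmodType) (phi : W -> 'F_2) (x0 : W) :
  {morph phi : x y / x + y} -> phi x0 != 0 -> \sum_x sg2 (phi x) = 0.
Proof.
move=> phiD px0; set S := \sum_x _.
have : S = - S.
  rewrite {1}/S (reindex_inj (addIr x0))/= -mulrN1 /S mulr_suml.
  by apply: eq_bigr => x _; rewrite phiD sg2D {2}/sg2 (negbTE px0).
lra.
Qed.

End sign_characters.

Section rank_one_walk.
Variables (R : realType) (n : nat).
Local Notation V := 'M['F_2]_n.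
Local Notation U := ('cV['F_2]_n * 'rV['F_2]_n)%type.

Definition dotm (B A : V) : 'F_2 := \sum_i \sum_j B i j * A i j.

Definition chi (B A : V) : R := sg2 R (dotm B A).

Lemma dotmC A B : dotm A B = dotm B A.
Proof. by apply: eq_bigr => i _; apply: eq_bigr => j _; rewrite mulrC. Qed.

Lemma dotmD B : {morph dotm B : A A' / A + A'}.
Proof.
move=> A A'; rewrite /dotm -big_split; apply: eq_bigr => i _.
by rewrite -big_split; apply: eq_bigr => j _; rewrite !mxE mulrDr.
Qed.

Lemma dotmN B A : dotm B (- A) = - dotm B A.
Proof.
rewrite /dotm -sumrN; apply: eq_bigr => i _; rewrite -sumrN.
by apply: eq_bigr => j _; rewrite mxE mulrN.
Qed.

Lemma chiB B A A' : chi B (A - A') = chi B A * chi B A'.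
Proof. by rewrite /chi dotmD dotmN sg2D sg2N. Qed.

Lemma sum_chi (A : V) : \sum_B chi B A = #|{: V}|%:R * (A == 0)%:R.
Proof.
have [->|A0] := eqVneq A 0.
  rewrite mulr1 -sumr_const; apply: eq_bigr => B _.
  by rewrite -(subrr 0) chiB /chi sg2_sqr.
rewrite mulr0 /chi; under eq_bigr do rewrite dotmC.
have [[i j] Aij] : exists ij, A ij.1 ij.2 != 0.
  apply/existsP; apply: contra_neqT A0; rewrite negb_exists => /forallP H.
  by apply/matrixP => i j; rewrite mxE; have := H (i, j); rewrite negbK => /eqP.
apply: (@sum_sg2_eq0 R _ (dotm A) (delta_mx i j)); first exact: dotmD.
rewrite /dotm (bigD1 i)//= [X in _ + X]big1 => [|i' ii']; last first.
  by rewrite big1// => j' _; rewrite mxE (negbTE ii') mulr0.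
rewrite (bigD1 j)//= big1 => [|j' jj']; last first.
  by rewrite mxE (negbTE jj') andbF mulr0.
by rewrite !addr0 mxE !eqxx mulr1.
Qed.

Definition rank1 (uv : U) : V := uv.1 *m uv.2.

Let cnt (T : finType) : R := #|T|%:R.

Let cnt_gt0 (T : finType) (x : T) : 0 < cnt T.
Proof. by rewrite ltr0n; apply/card_gt0P; exists x. Qed.

(** For fixed u the sum over v vanishes unless the row u^T B is zero. Testing only coordinate j of
    that row, for a nonzero column j of B, leaves half of the u. Hence the nontrivial eigenvalues of
    the walk are at most 1/2. *)
Lemma sum_chi_rank1 (B : V) : B != 0 ->
  \sum_(uv : U) chi B (rank1 uv) <= #|{: U}|%:R / 2.
Proof.
move=> B0.
have [[i j] /= Bij] : exists ij, B ij.1 ij.2 != 0.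
  apply/existsP; apply: contra_neqT B0; rewrite negb_exists => /forallP H.
  by apply/matrixP => i j; rewrite mxE; have := H (i, j); rewrite negbK => /eqP.
pose c (u : 'cV['F_2]_n) := \sum_i B i j * u i 0.
have dotE (u : 'cV_n) (v : 'rV_n) :
    dotm B (u *m v) = \sum_i \sum_j B i j * (u i 0 * v 0 j).
  by apply: eq_bigr => k _; apply: eq_bigr => l _; rewrite mxE big_ord1.
have chi_le1 A : chi B A <= 1.
  by rewrite /chi /sg2; case: ifP => // _; rewrite lerN10.
(* The factor (1 + [sg2 R (c u)]) / 2 is the indicator of c u = 0. *)
have row (u : 'cV_n) : \sum_v chi B (rank1 (u, v)) <=
    cnt 'rV['F_2]_n * ((1 + sg2 R (c u)) / 2).
  have [cu|cu] := eqVneq (c u) 0.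
    rewrite {1}/sg2 cu eqxx divff ?pnatr_eq0// mulr1 /cnt -sumr_const.
    by apply: ler_sum => v _; exact: chi_le1.
  rewrite {1}/sg2 (negbTE cu) subrr mul0r mulr0 /chi.
  rewrite (@sum_sg2_eq0 R _ (fun v => dotm B (rank1 (u, v))) (delta_mx 0 j))//.
    by move=> v v'; rewrite /rank1/= mulmxDr dotmD.
  rewrite /rank1/= dotE.
  suff -> : \sum_i \sum_l B i l * (u i 0 * (delta_mx 0 j : 'rV_n) 0 l) = c u by [].
  apply: eq_bigr => k _; rewrite (bigD1 j)//= big1 => [|l lj]; last first.
    by rewrite mxE (negbTE lj) andbF !mulr0.
  by rewrite addr0 mxE !eqxx mulr1.
rewrite -(pair_bigA _ (fun u v => chi B (rank1 (u, v))))/=.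
apply: le_trans (ler_sum _ (fun u _ => row u)) _.
rewrite -mulr_sumr -mulr_suml big_split/= sumr_const.
rewrite (@sum_sg2_eq0 R _ c (delta_mx i 0)) ?addr0; last 2 first.
- move=> u u'; rewrite /c -big_split; apply: eq_bigr => k _.
  by rewrite mxE mulrDr.
- rewrite /c (bigD1 i)//= big1 => [|k ki]; last by rewrite mxE (negbTE ki) mulr0.
  by rewrite addr0 mxE !eqxx mulr1.
by rewrite card_prod natrM [X in _ <= X / 2]mulrC mulrA.
Qed.

Definition walk (x y : V) : R :=
  #|{: U}|%:R^-1 * \sum_(uv : U) (y == x + rank1 uv)%:R.

Lemma sum_walkr (F : V -> V -> R) x : \sum_y walk x y * F x y =
  #|{: U}|%:R^-1 * \sum_(uv : U) F x (x + rank1 uv).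
Proof.
under eq_bigr do rewrite /walk -mulrA mulr_suml.
rewrite -mulr_sumr exchange_big/=; congr (_ * _); apply: eq_bigr => uv _.
rewrite (bigD1 (x + rank1 uv))//= eqxx mul1r big1 ?addr0// => y yx.
by rewrite (negbTE yx) mul0r.
Qed.

Lemma sum_walkl (F : V -> V -> R) y : \sum_x walk x y * F x y =
  #|{: U}|%:R^-1 * \sum_(uv : U) F (y - rank1 uv) y.
Proof.
under eq_bigr do rewrite /walk -mulrA mulr_suml.
rewrite -mulr_sumr exchange_big/=; congr (_ * _); apply: eq_bigr => uv _.
rewrite (bigD1 (y - rank1 uv))//= subrK eqxx mul1r big1 ?addr0// => x xy.
by rewrite -subr_eq eq_sym (negbTE xy) mul0r.
Qed.

Let nU_gt0 : 0 < #|{: U}|%:R :> R.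
Proof. exact: cnt_gt0 (0, 0). Qed.

Lemma bistochastic_walk : bistochastic walk.
Proof.
split=> [x y|x|y].
- by apply: mulr_ge0; [rewrite invr_ge0 ltW|exact: sumr_ge0].
- have := sum_walkr (fun _ _ => 1) x; under eq_bigr do rewrite mulr1.
  by move=> ->; rewrite sumr_const mulVf// gt_eqF.
- have := sum_walkl (fun _ _ => 1) y; under eq_bigr do rewrite mulr1.
  by move=> ->; rewrite sumr_const mulVf// gt_eqF.
Qed.

Section Fourier.
Variable f : V -> R.
Let N : R := #|{: V}|%:R.
Let H B := \sum_A f A * chi B A.
Let N0 : 0 < N. Proof. exact: cnt_gt0 0. Qed.

(** Plancherel for f and its translate by M, from orthogonality of the characters; M = 0 gives
    Parseval. *)
Let Fourier_shift M : \sum_B H B ^+ 2 * chi B M = N * \sum_A f A * f (A + M).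
Proof.
transitivity (\sum_B \sum_A \sum_A' f A * f A' * chi B (A + M - A')).
  apply: eq_bigr => B _; rewrite expr2 -mulrA {1}/H mulr_suml.
  apply: eq_bigr => A _; rewrite mulrCA /H mulr_suml.
  apply: eq_bigr => A' _; rewrite chiB -[M]opprK chiB opprK.
  have -> : chi B (- M) = chi B M by rewrite /chi dotmN sg2N.
  by ring.
rewrite exchange_big/= mulr_sumr; apply: eq_bigr => A _.
rewrite exchange_big/=.
under eq_bigr do rewrite -mulr_sumr sum_chi.
rewrite (bigD1 (A + M))//= big1 => [|A' A'M]; last first.
  by rewrite subr_eq0 eq_sym (negbTE A'M) !mulr0.
by rewrite subrr eqxx mulr1 addr0 mulrC.
Qed.

Let S2 := \sum_A f A ^+ 2.
Let S1 := \sum_A f A.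

Let Parseval : \sum_B H B ^+ 2 = N * S2.
Proof.
have <- : \sum_B H B ^+ 2 * chi B 0 = \sum_B H B ^+ 2.
  by apply: eq_bigr => B _; rewrite -(subrr 0) chiB /chi sg2_sqr mulr1.
by rewrite Fourier_shift; congr (_ * _); apply: eq_bigr => A _; rewrite addr0.
Qed.

Let H0 : H 0 = S1.
Proof.
apply: eq_bigr => A _; rewrite /chi (_ : dotm 0 A = 0) /sg2 ?eqxx ?mulr1//.
by rewrite /dotm big1// => i _; rewrite big1// => j _; rewrite mxE mul0r.
Qed.

(** On the Fourier side the walk multiplies the square of [H B] by an eigenvalue at most 1/2 for B
    != 0 and by 1 = 1/2 + 1/2 at B = 0, where [H 0] is the sum of f. *)
Let correlation : N * (\sum_(uv : U) \sum_A f A * f (A + rank1 uv)) <=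
  #|{: U}|%:R * (N * S2 / 2 + S1 ^+ 2 / 2).
Proof.
rewrite mulr_sumr; under eq_bigr do rewrite -Fourier_shift.
rewrite exchange_big/=; under eq_bigr do rewrite -mulr_sumr.
have bound B : H B ^+ 2 * (\sum_(uv : U) chi B (rank1 uv)) <=
    #|{: U}|%:R * (H B ^+ 2 / 2 + (if B == 0 then H B ^+ 2 / 2 else 0)).
  case: eqP => [->|/eqP B0].
    rewrite -splitr mulrC ler_wpM2r ?sqr_ge0// -sumr_const.
    by apply: ler_sum => uv _; rewrite /chi /sg2; case: ifP => // _; rewrite lerN10.
  by rewrite addr0 [leRHS]mulrCA ler_wpM2l ?sqr_ge0 ?sum_chi_rank1.
apply: le_trans (ler_sum _ (fun B _ => bound B)) _.
rewrite -mulr_sumr big_split/= -mulr_suml Parseval.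
by rewrite -big_mkcond big_pred1_eq H0.
Qed.

Let pair_energy : \sum_x \sum_y (f x - f y) ^+ 2 = 2 * (N * S2 - S1 ^+ 2).
Proof.
transitivity (\sum_x \sum_y (f x ^+ 2 + f y ^+ 2 - 2 * (f x * f y))).
  by apply: eq_bigr => x _; apply: eq_bigr => y _; ring.
under eq_bigr do rewrite sumrB big_split/= sumr_const -!mulr_sumr.
rewrite sumrB big_split/= sumr_const sumrMnl -!mulr_sumr -mulr_suml -/S1 -/S2.
by rewrite -!(mulr_natl S2) -/N; ring.
Qed.

Let walk_energy : \sum_x \sum_y walk x y * (f x - f y) ^+ 2 =
  2 * (S2 - #|{: U}|%:R^-1 * \sum_(uv : U) \sum_A f A * f (A + rank1 uv)).
Proof.
under eq_bigr do rewrite (sum_walkr (fun x y => (f x - f y) ^+ 2)).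
rewrite -mulr_sumr exchange_big/=.
transitivity (#|{: U}|%:R^-1 * \sum_(uv : U)
    (2 * (S2 - \sum_A f A * f (A + rank1 uv)))).
  congr (_ * _); apply: eq_bigr => uv _.
  transitivity (\sum_x (f x ^+ 2 + f (x + rank1 uv) ^+ 2 -
      2 * (f x * f (x + rank1 uv)))).
    by apply: eq_bigr => x _; ring.
  have S2E : S2 = \sum_x f (x + rank1 uv) ^+ 2.
    by rewrite /S2 (reindex_inj (addIr (rank1 uv))).
  by rewrite sumrB big_split/= -mulr_sumr -S2E -/S2; ring.
rewrite -mulr_sumr sumrB sumr_const -(mulr_natl S2).
by rewrite mulrCA mulrBr mulKf// gt_eqF.
Qed.

Lemma walk_spectral_gap : \sum_x \sum_y (f x - f y) ^+ 2 <=
  2 * N * \sum_x \sum_y walk x y * (f x - f y) ^+ 2.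
Proof.
rewrite pair_energy walk_energy.
have := correlation; set c := \sum_uv _; set u := #|_|%:R => cor.
have u0 : 0 < u := nU_gt0.
have : N * (u^-1 * c) <= N * S2 / 2 + S1 ^+ 2 / 2.
  by rewrite mulrCA ler_pdivrMl.
rewrite -!mulrA ler_pM2l//; move: (u^-1 * c) => z; nra.
Qed.

End Fourier.
End rank_one_walk.

(** * Pairs of matrices at large rank distance *)

Section far_pairs.
Variable R : realType.

Lemma card_low_rank (n k : nat) :
  (#|[set A : 'M['F_2]_n | (\rank A <= k)%N]%SET| <= 2 ^ (n * k + k * n))%N.
Proof.
pose mulp (LR : 'M['F_2]_(n, k) * 'M['F_2]_(k, n)) := LR.1 *m LR.2.
suff sub : [set A : 'M['F_2]_n | (\rank A <= k)%N]%SET \subset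
    mulp @: [set: 'M['F_2]_(n, k) * 'M['F_2]_(k, n)]%SET.
  apply: leq_trans (subset_leq_card sub) _.
  apply: leq_trans (leq_imset_card _ _) _.
  by rewrite cardsT card_prod !card_mx card_Fp// -expnD.
apply/fintype.subsetP => A; rewrite inE => rA; apply/imsetP.
exists (col_ebase A *m pid_mx (\rank A), pid_mx (\rank A) *m row_ebase A) => //.
rewrite /mulp/= mulmxA -(mulmxA (col_ebase A)) mul_pid_mx.
by rewrite minnn (minn_idPr rA) mulmx_ebase.
Qed.

(** With n = 2k + 1 there are at most 2^(2nk) = 2^(n^2 - n) matrices of rank at most k, hence at
    most half of all. *)
Lemma card_high_rank (k : nat) :
  (#|{: 'M['F_2]_(k.*2.+1)}| <=
   2 * #|[pred A : 'M['F_2]_(k.*2.+1) | k < \rank A]|)%N.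
Proof.
set n := k.*2.+1.
have cV : #|{: 'M['F_2]_n}| = (2 ^ (n * n))%N by rewrite card_mx card_Fp.
have low : (2 * #|[set A : 'M['F_2]_n | (\rank A <= k)%N]%SET| <= #|{: 'M['F_2]_n}|)%N.
  rewrite cV; apply: (@leq_trans (2 ^ (n * k + k * n).+1)).
    by rewrite expnS leq_mul2l card_low_rank.
  by rewrite leq_exp2l// /n -addnn; nia.
have split : (#|[set A : 'M['F_2]_n | (\rank A <= k)%N]%SET| +
    #|[pred A : 'M['F_2]_n | k < \rank A]| = #|{: 'M['F_2]_n}|)%N.
  rewrite -(cardC (mem [set A : 'M['F_2]_n | (\rank A <= k)%N]%SET)); congr (_ + _)%N.
  by apply: eq_card => A; rewrite !inE ltnNge.
lia.
Qed.

(** Take the far pair with least N and the edge with greatest N: at least half of all pairs are far,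
    which bounds the left side below and produces the factor 2, while the walk average is at most
    the value on that edge. *)
Lemma exists_far_pair (k : nat) (C : R)
    (N : 'M['F_2]_(k.*2.+1) -> 'M['F_2]_(k.*2.+1) -> R) :
  0 <= C -> (forall x y, 0 <= N x y) ->
  \sum_x \sum_y N x y <=
    C * #|{: 'M['F_2]_(k.*2.+1)}|%:R * \sum_x \sum_y walk R x y * N x y ->
  exists v v' e e', [/\ (k < \rank (v - v')%R)%N, (\rank (e - e')%R <= 1)%N &
    N v v' <= 2 * C * N e e'].
Proof.
set n := k.*2.+1; set V := 'M['F_2]_n => C0 N0 H.
pose U := ('cV['F_2]_n * 'rV['F_2]_n)%type.
have [[e uv] _ emax] := @Order.TotalTheory.arg_maxP _ _ (V * U)%type
  (0, (0, 0)) xpredT (fun xe => N xe.1 (xe.1 + rank1 xe.2)) isT.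
pose m := N e (e + rank1 uv).
have highP : (0 < #|[pred A : V | (k < \rank A)%N]|)%N.
  have := card_high_rank k; rewrite -/n -/V; have : (0 < #|{: V}|)%N.
    by apply/card_gt0P; exists 0.
  lia.
have [A0 kA0] := card_gt0P highP; rewrite inE in kA0.
have p0 : (k < \rank (A0 - 0 : V)%R)%N by rewrite subr0.
have [[v v'] /= far vmin] := @Order.TotalTheory.arg_minP _ _ (V * V)%type
  (A0, 0) (fun p => (k < \rank (p.1 - p.2)%R)%N) (fun p => N p.1 p.2) p0.
exists v, v', e, (e + rank1 uv); split => //.
  rewrite opprD addrA subrr sub0r mxrank_opp /rank1.
  apply: leq_trans (mxrankM_maxl _ _) _; exact: rank_leq_col.
have V0 : 0 < #|{: V}|%:R :> R by rewrite ltr0n; apply/card_gt0P; exists 0.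
have U0 : 0 < #|{: U}|%:R :> R by rewrite ltr0n; apply/card_gt0P; exists (0, 0).
have upper : \sum_x \sum_y walk R x y * N x y <= #|{: V}|%:R * m.
  rewrite mulr_natl -sumr_const; apply: ler_sum => x _.
  rewrite sum_walkr ler_pdivrMl// mulr_natl -sumr_const.
  by apply: ler_sum => u _; exact: (emax (x, u)).
have lower : #|{: V}|%:R * (#|{: V}|%:R / 2 * N v v') <= \sum_x \sum_y N x y.
  rewrite mulr_natl -sumr_const; apply: ler_sum => x _.
  apply: (@le_trans _ _ (\sum_(y | (k < \rank (x - y)%R)%N) N x y)); last first.
    rewrite [leRHS](bigID (fun y => (k < \rank (x - y)%R)%N))/=.
    by rewrite lerDl sumr_ge0.
  apply: (@le_trans _ _ (\sum_(y | (k < \rank (x - y)%R)%N) N v v')); last first.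
    by apply: ler_sum => y xy; exact: (vmin (x, y)).
  rewrite (reindex_inj (inj_comp (addrI x) oppr_inj))/=.
  under eq_bigl do rewrite opprB addrCA subrr addr0.
  rewrite sumr_const -(mulr_natl (N v v')) ler_wpM2r//.
  rewrite ler_pdivrMr// mulrC -natrM ler_nat; exact: card_high_rank.
have := le_trans lower (le_trans H (ler_wpM2l (mulr_ge0 C0 (ltW V0)) upper)).
set c := #|_|%:R in V0 *; have -> : C * c * (c * m) = c * (c * (C * m)) by ring.
by rewrite ler_pM2l// -mulrA ler_pM2l// ler_pdivrMl// mulrA.
Qed.

End far_pairs.

(** * Poincare inequality in L_r *)

Section Lr_interface.
Variables (R : realType) (r : R) (r1 : 1 <= r).
Local Notation mu := (@lebesgue01 R).
Local Notation TR := (measurableTypeR R).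
Local Notation L := (@LfunType _ TR R mu r%:E r1).

Definition Lr_fun (F : Lr r1) : TR -> R := Lspace_repr F.

Lemma measurable_Lr_fun F : measurable_fun setT (Lr_fun F).
Proof. exact: (measurable_funPT (Lspace_repr F)). Qed.

Lemma Lspace_classN (f : L) : Lspace_class (- f) = - Lspace_class f.
Proof. by rewrite -scaleN1r Lspace_classZ scaleN1r. Qed.

Lemma Lr_norm_pow (F G : Lr r1) :
  (`|F - G| `^ r)%:E = (\int[mu]_x (`|Lr_fun F x - Lr_fun G x| `^ r)%:E)%E.
Proof.
have r0 : r != 0 by rewrite gt_eqF// (lt_le_trans ltr01).
rewrite -{1}(Lspace_reprK F) -{1}(Lspace_reprK G) -Lspace_classN -Lspace_classD.
rewrite Lspace_norm_class -poweR_EFin finite_norm_fine powR_Lnorm//.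
Qed.

Lemma measurable_pow_dist (f g : TR -> R) : measurable_fun setT f ->
  measurable_fun setT g ->
  measurable_fun setT (fun x => (`|f x - g x| `^ r)%:E).
Proof.
move=> mf mg; apply/measurable_EFinP.
apply: (@measurableT_comp _ _ _ _ _ _ (fun x => x `^ r)); first exact: measurable_powR.
by apply: measurableT_comp => //; exact: measurable_funB.
Qed.

(** The exponent of the inequality is that of the space, so the scalar inequality is applied at
    every point t and integrated. *)
Lemma poincare_Lr (V : finType) (w : V -> V -> R) (C : R) : 0 <= C ->
  (forall x y, 0 <= w x y) -> poincare R^o w r C -> poincare (Lr r1) w r C.
Proof.
move=> C0 w0 HP f.
pose d x y t := `|Lr_fun (f x) t - Lr_fun (f y) t| `^ r.
have d0 x y t : (0 <= (d x y t)%:E)%E by rewrite lee_fin powR_ge0.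
have md x y : measurable_fun setT (fun t => (d x y t)%:E).
  by apply: measurable_pow_dist; exact: measurable_Lr_fun.
have mc (c : V -> V -> R) x y : measurable_fun setT (fun t => (c x y * d x y t)%:E).
  by under eq_fun do rewrite EFinM; exact: measurable_funeM.
have msum1 (c : V -> V -> R) x :
    measurable_fun setT (fun t => (\sum_y c x y * d x y t)%:E).
  by under eq_fun do rewrite -sumEFin; exact: emeasurable_sum.
have msum (c : V -> V -> R) :
    measurable_fun setT (fun t => (\sum_x \sum_y c x y * d x y t)%:E).
  by under eq_fun do rewrite -sumEFin; exact: emeasurable_sum.
have sumE (c : V -> V -> R) : (forall x y, 0 <= c x y) ->
    (\sum_x \sum_y c x y * `|f x - f y| `^ r)%:E =
    (\int[mu]_t (\sum_x \sum_y c x y * d x y t)%:E)%E.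
  move=> c0; rewrite -sumEFin.
  under [RHS]eq_integral do rewrite -sumEFin.
  rewrite ge0_integral_sum//; last first.
    by move=> x t _; rewrite lee_fin sumr_ge0// => y _; rewrite mulr_ge0 ?powR_ge0.
  apply: eq_bigr => x _; rewrite -sumEFin.
  under [RHS]eq_integral do rewrite -sumEFin.
  rewrite ge0_integral_sum//; last first.
    by move=> y t _; rewrite lee_fin mulr_ge0 ?powR_ge0.
  apply: eq_bigr => y _; under [RHS]eq_integral do rewrite EFinM.
  by rewrite ge0_integralZl_EFin// EFinM Lr_norm_pow.
have := sumE (fun _ _ => 1) (fun _ _ => ler01).
under eq_bigr do under eq_bigr do rewrite mul1r.
rewrite -lee_fin => ->.
have -> : C * #|V|%:R * (\sum_x \sum_y w x y * `|f x - f y| `^ r) =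
    \sum_x \sum_y (C * #|V|%:R * w x y) * `|f x - f y| `^ r.
  rewrite mulr_sumr; apply: eq_bigr => x _; rewrite mulr_sumr.
  by apply: eq_bigr => y _; rewrite mulrA.
rewrite sumE => [|x y]; last by rewrite !mulr_ge0.
apply: ge0_le_integral => //.
- move=> t _; rewrite lee_fin sumr_ge0// => x _; rewrite sumr_ge0// => y _.
  by rewrite mul1r powR_ge0.
- move=> t _; rewrite lee_fin.
  under eq_bigr do under eq_bigr do rewrite mul1r.
  apply: le_trans (HP (fun x => Lr_fun (f x) t)) _.
  rewrite mulr_sumr; apply: ler_sum => x _; rewrite mulr_sumr.
  by apply: ler_sum => y _; rewrite mulrA.
Qed.

(** The spectral gap is the scalar inequality with exponent 2; extrapolation gives exponent r,
    integration carries it to L_r, and a second extrapolation gives exponent q. No constant depends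
    on the matrix size. *)
Theorem poincare_walk_Lr (q : R) : 1 <= q ->
  exists2 C : R, 0 <= C & forall n, poincare (Lr r1) (@walk R n) q C.
Proof.
move=> q1; have r0 : 0 < r := lt_le_trans ltr01 r1.
have q0 : 0 < q := lt_le_trans ltr01 q1.
have [C1 C10 H1] := @poincare_extrapolation R 2 r 2 (ltr0Sn _ 1) r0 (ler0n _ 2).
have [C2 C20 H2] := poincare_extrapolation r0 q0 C10.
exists C2 => // n; have bw := bistochastic_walk R n.
apply: H2 => //; apply: poincare_Lr => //; first by case: bw.
apply: H1 => // f.
have sq (x y : 'M['F_2]_n) : `|f x - f y| `^ 2 = (f x - f y) ^+ 2.
  by rewrite powR_mulrn// real_normK// num_real.
under eq_bigr do under eq_bigr do rewrite sq.
apply: le_trans (walk_spectral_gap (f : _ -> R)) _.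
rewrite ler_wpM2l ?mulr_ge0//; apply: ler_sum => x _.
by apply: ler_sum => y _; rewrite sq.
Qed.

End Lr_interface.

(** * Separability of L_r *)

Section clamp.
Variable R : realType.
Implicit Types n x y : R.

Definition clamp n x : R := Num.max (- n) (Num.min n x).

Lemma clamp_Lipschitz n x y : `|clamp n x - clamp n y| <= `|x - y|.
Proof.
have maxL a u v : `|Num.max a u - Num.max a v| <= `|u - v| :> R.
  have := ler_norm (u - v); have := ler_norm (- (u - v)); rewrite normrN.
  by case: (leP a u); case: (leP a v); rewrite ler_norml; lra.
have minL a u v : `|Num.min a u - Num.min a v| <= `|u - v| :> R.
  have := ler_norm (u - v); have := ler_norm (- (u - v)); rewrite normrN.
  by case: (leP a u); case: (leP a v); rewrite ler_norml; lra.
exact: le_trans (maxL _ _ _) (minL _ _ _).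
Qed.

Lemma clamp_id n x : `|x| <= n -> clamp n x = x.
Proof.
by rewrite ler_norml /clamp => /andP[nx xn]; rewrite (min_idPr xn) (max_idPr nx).
Qed.

Lemma clamp_norm n x : 0 <= n -> `|clamp n x| <= n.
Proof.
move=> n0; rewrite ler_norml /clamp le_max lexx/= ge_max ge_min lexx andbT.
by rewrite (le_trans _ n0)// oppr_le0.
Qed.

Lemma clamp_dist n x : 0 <= n -> `|x - clamp n x| <= `|x|.
Proof.
move=> n0; have := ler_norm x; have := ler_norm (- x).
rewrite normrN ler_norml /clamp; have [nx|xn] := leP n x.
  by rewrite max_r ?ge0_cp// => ? ?; apply/andP; lra.
by have [nx|nx] := leP (- n) x => h1 h2; apply/andP; split; lra.
Qed.

End clamp.

Section Lr_separability.
Variables (R : realType) (r : R) (r1 : 1 <= r).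
Local Notation mu := (@lebesgue01 R).
Local Notation leb := (@lebesgue_measure R).
Local Notation TR := (measurableTypeR R).
Local Notation I01 := (`[0, 1]%classic : set TR).
Let r0 : 0 < r := lt_le_trans ltr01 r1.

Let mI : measurable I01. Proof. exact: measurable_itv. Qed.

Lemma integral_lebesgue01 (h : TR -> \bar R) : measurable_fun setT h ->
  (forall x, (0 <= h x)%E) ->
  (\int[mu]_x h x = \int[leb]_(x in I01) h x)%E.
Proof.
move=> mh h0.
rewrite (@ge0_negligible_integral _ _ _ mu setT (~` I01))//; last 2 first.
- exact: measurableC.
- by rewrite /= /lebesgue01 /mrestr setICl measure0.
rewrite setTD setCK; apply: eq_measure_integral => A mA AI.
by rewrite /= /lebesgue01 /mrestr setIidl.
Qed.

(** The r-th power of the L_r distance, with extended values so that arbitrary measurable functions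
    can be compared without first being shown to lie in L_r. *)
Definition Ldist (f g : TR -> R) : \bar R := (\int[mu]_x (`|f x - g x| `^ r)%:E)%E.

Lemma LdistC f g : Ldist f g = Ldist g f.
Proof. by apply: eq_integral => x _; rewrite distrC. Qed.

Lemma Ldist_triangle f g h : measurable_fun setT f -> measurable_fun setT g ->
  measurable_fun setT h ->
  (Ldist f h <= (2 `^ r)%:E * (Ldist f g + Ldist g h))%E.
Proof.
move=> mf mg mh.
have mfg := measurable_pow_dist r mf mg.
have mgh := measurable_pow_dist r mg mh.
rewrite /Ldist -ge0_integralD//; try by move=> x _; rewrite lee_fin powR_ge0.
rewrite -ge0_integralZl_EFin ?powR_ge0//; last 2 first.
- by move=> x _; rewrite -EFinD lee_fin addr_ge0 ?powR_ge0.
- exact: emeasurable_funD.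
apply: ge0_le_integral => //.
- exact: measurable_pow_dist.
- by apply: measurable_funeM; exact: emeasurable_funD.
- move=> x _; rewrite -EFinD -EFinM lee_fin.
  apply: le_trans (powR_quasi_triangle _ _ (ltW r0)) => //.
  by rewrite powR_le_mono// ler_distD.
Qed.

(** Dominated convergence: at each point the truncation error is eventually 0, and it never exceeds
    the absolute value of the function. *)
Lemma truncation_approx (F : Lr r1) (e : R) : 0 < e ->
  exists n : nat, (Ldist (Lr_fun F) (clamp n%:R \o Lr_fun F) <= e%:E)%E.
Proof.
move=> e0; set phi := Lr_fun F.
have mphi : measurable_fun setT phi := measurable_Lr_fun F.
have mcl n : measurable_fun setT (clamp n \o phi).
  apply: measurable_maxr => //; exact: measurable_minr.
pose f n x := (`|phi x - clamp n%:R (phi x)| `^ r)%:E.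
have mf n : measurable_fun setT (f n).
  exact: (measurable_pow_dist r mphi (mcl n%:R)).
have int : mu.-integrable setT (fun x => (`|phi x| `^ r)%:E).
  apply/integrableP; split.
    have m0 : measurable_fun setT (fun _ : TR => 0 : R) by exact: measurable_cst.
    by have := measurable_pow_dist r mphi m0; under eq_fun do rewrite subr0.
  under eq_integral do rewrite gee0_abs ?lee_fin ?powR_ge0//.
  have := @Lfunction_finite _ _ _ _ _ _ (Lspace_repr F).
  rewrite /finite_norm => fin.
  have /= <- := powR_Lnorm mu (EFin \o phi) (lt0r_neq0 r0).
  by apply: poweR_lty.
have [] := @dominated_convergence _ _ _ mu setT measurableT f (cst 0%E) _ mf _ _ int _.
- exact: measurable_cst.
- apply: aeW => x _; apply: cvg_near_cst.
  exists (Num.truncn `|phi x|).+1 => // n /= tn.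
  rewrite /f clamp_id ?subrr ?normr0 ?powR0 ?gt_eqF//.
  by apply: ltW; apply: lt_le_trans (truncnS_gt _) _; rewrite ler_nat.
- apply: aeW => x n _; rewrite /f gee0_abs ?lee_fin ?powR_ge0//.
  by rewrite powR_le_mono// clamp_dist.
move=> _ _; rewrite integral0 => /fine_cvgP[fin] /cvgrPdist_le/(_ e e0) cv.
have [N _ HN] := filterI fin cv; have [finN] := HN N (leqnn N).
rewrite /= sub0r normrN => cN; exists N.
have finE : (\int[mu]_x f N x)%E \is a fin_num by exact: finN.
rewrite -[Ldist _ _]/(\int[mu]_x f N x)%E -(fineK finE) lee_fin.
exact: le_trans (ler_norm _) cN.
Qed.

(** For functions bounded by n the factor |f - g|^(r - 1) is at most (2n)^(r - 1), so that density
    of continuous functions in L_1 is enough. *)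
Lemma Ldist_le_L1 (n : R) (f g : TR -> R) : 0 <= n -> measurable_fun setT f ->
  measurable_fun setT g -> (forall x, `|f x| <= n) ->
  (Ldist f (clamp n \o g) <=
   ((2 * n) `^ (r - 1))%:E * \int[leb]_(x in I01) `|(f x - g x)%:E|)%E.
Proof.
move=> n0 mf mg fn.
have mcg : measurable_fun setT (clamp n \o g).
  by apply: measurable_maxr => //; exact: measurable_minr.
have mfg : measurable_fun setT (fun x => `|(f x - g x)%:E|%E).
  by apply: measurableT_comp => //; apply/measurable_EFinP; exact: measurable_funB.
rewrite /Ldist integral_lebesgue01; last 2 first.
- exact: measurable_pow_dist.
- by move=> x; rewrite lee_fin powR_ge0.
have mfg' : measurable_fun I01 (fun x => `|(f x - g x)%:E|%E).
  exact: measurable_funTS.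
rewrite -ge0_integralZl_EFin ?powR_ge0//.
apply: ge0_le_integral => //.
- by apply: measurable_funTS; exact: measurable_pow_dist.
- exact: measurable_funeM.
- move=> x _; rewrite abse_EFin -EFinM lee_fin /=.
  rewrite -(mulr_powRB1 (normr_ge0 _) r0) mulrC ler_pM ?powR_ge0//.
    rewrite ge0_ler_powR ?subr_ge0 ?nnegrE ?mulr_ge0//.
    rewrite (le_trans (ler_normB _ _))// mulr_natl mulr2n lerD//.
    exact: clamp_norm.
  by rewrite -{1}(clamp_id (fn x)) clamp_Lipschitz.
Qed.

Lemma continuous_approx (F : Lr r1) (e : R) : 0 < e ->
  exists g : R -> R, continuous g /\ (Ldist (Lr_fun F) g <= e%:E)%E.
Proof.
move=> e0; pose c : R := 2 `^ r; have c0 : 0 < c by rewrite powR_gt0.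
have e20 : 0 < e / (2 * c) by rewrite divr_gt0// mulr_gt0.
have [n Hn] := truncation_approx F e20.
have mF := measurable_Lr_fun F.
set f := clamp n%:R \o Lr_fun F in Hn.
have mf : measurable_fun setT f.
  by apply: measurable_maxr => //; exact: measurable_minr.
have fn x : `|f x| <= n%:R by exact: clamp_norm.
have Ifin : (leb I01 < +oo)%E.
  by rewrite lebesgue_measure_itv/= lte_fin ltr01 -EFinB ltry.
have intf : leb.-integrable I01 (EFin \o f).
  apply: measurable_bounded_integrable => //; first exact: measurable_funTS.
  exists n%:R; split; first exact: num_real.
  by move=> M nM x _; exact: le_trans (fn x) (ltW nM).
have [g [cg _ gcv]] := approximation_continuous_integrable mI Ifin intf.
pose K : R := (2 * n%:R) `^ (r - 1) + 1.
have K0 : 0 < K by rewrite ltr_wpDl ?powR_ge0.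
have eK0 : 0 < e / (2 * c) / K by rewrite divr_gt0.
move: gcv => /fine_cvgP[fin] /cvgrPdist_le/(_ _ eK0) cv.
have [N _ HN] := filterI fin cv; have [finN] := HN N (leqnn N).
rewrite /= sub0r normrN => cN.
have mg : measurable_fun setT (g N) by exact: continuous_measurable_fun.
exists (clamp n%:R \o g N); split.
  move=> x; apply/cvgrPdist_le => d d0.
  have /cvgrPdist_le/(_ d d0) := cg N x.
  by apply: filterS => t; apply: le_trans; exact: clamp_Lipschitz.
have mcg : measurable_fun setT (clamp n%:R \o g N).
  by apply: measurable_maxr => //; exact: measurable_minr.
apply: le_trans (Ldist_triangle mF mf mcg) _.
have -> : e%:E = (c%:E * ((e / (2 * c))%:E + (e / (2 * c))%:E))%E.
  by rewrite -EFinD -EFinM; congr EFin; field; rewrite gt_eqF.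
apply: lee_wpmul2l; first by rewrite lee_fin ltW.
apply: leeD; first exact: Hn.
apply: le_trans (Ldist_le_L1 (ler0n _ n) mf mg fn) _.
have finE : (\int[leb]_(x in I01) `|(f x - g N x)%:E|)%E \is a fin_num.
  exact: finN.
rewrite -(fineK finE) -EFinM lee_fin.
apply: (@le_trans _ _ (K * (e / (2 * c) / K))).
  rewrite ler_pM ?powR_ge0//; first by rewrite fine_ge0// integral_ge0.
    by rewrite lerDl.
  exact: le_trans (ler_norm _) cN.
by rewrite mulrC divfK// gt_eqF.
Qed.

Lemma Ldist_le_sup (f g : TR -> R) (e : R) : measurable_fun setT f ->
  measurable_fun setT g -> (forall t : R, 0 <= t <= 1 -> `|f t - g t| `^ r <= e) ->
  (Ldist f g <= e%:E)%E.
Proof.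
move=> mf mg fg; rewrite /Ldist integral_lebesgue01; last 2 first.
- exact: measurable_pow_dist.
- by move=> x; rewrite lee_fin powR_ge0.
apply: (@le_trans _ _ (\int[leb]_(x in I01) e%:E)%E).
  apply: ge0_le_integral => //.
  by apply: measurable_funTS; exact: measurable_pow_dist.
have I1 : leb I01 = 1%E.
  by rewrite lebesgue_measure_itv/= lte_fin ltr01 -EFinB subr0.
apply: (@le_trans _ _ (e%:E * leb I01)%E); first by rewrite integral_cst.
by rewrite I1 mule1.
Qed.

Theorem Lr_separable : separable (Lr r1).
Proof.
apply: (@separable_of_cover R (nat * seq int)%type) => rho rho0.
pose c : R := 2 `^ r; have c0 : 0 < c by rewrite powR_gt0.
have c1 : 1 <= c by rewrite -(powRr0 2) ler_powR// ?ler1n// ltW.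
(* Two quasi-triangle inequalities bound three errors eta by 3 c^2 eta. The next choice makes (4
   e)^r = eta, for two functions each within 2 e of a common step function. *)
pose eta := rho `^ r / (3 * c ^+ 2).
have eta0 : 0 < eta by rewrite divr_gt0 ?powR_gt0// mulr_gt0// exprn_gt0.
pose e := eta `^ r^-1 / 4.
have e0 : 0 < e by rewrite divr_gt0// powR_gt0.
exists (fun s F => exists g : R -> R, [/\ continuous g,
  (Ldist (Lr_fun F) g <= eta%:E)%E &
  forall t : R, 0 <= t <= 1 -> `|g t - step e s t| <= 2 * e]).
split=> [F|s F G [f [cf Ff fs]] [g [cg Gg gs]]].
  have [g [cg Fg]] := continuous_approx F eta0.
  have g01 : continuous_on01 g.
    move=> x _ d d0; have /cvgrPdist_le/(_ d d0)/nbhs_ballP[b /= b0 Hb] := cg x.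
    exists b => // t _ tx; rewrite distrC; apply: Hb.
    by rewrite -ball_normE/= distrC.
  by have [s gs] := step_approximation g01 e0; exists s, g.
have mf : measurable_fun setT f by exact: continuous_measurable_fun.
have mg : measurable_fun setT g by exact: continuous_measurable_fun.
have mF := measurable_Lr_fun F; have mG := measurable_Lr_fun G.
have fg : (Ldist f g <= eta%:E)%E.
  apply: Ldist_le_sup => // t t01.
  have -> : eta = (4 * e) `^ r.
    rewrite /e mulrC divfK ?pnatr_eq0// -powRrM mulVf ?gt_eqF// powRr1//.
    exact: ltW.
  apply: powR_le_mono => //; have := fs t t01; have := gs t t01.
  rewrite !ler_norml => /andP[? ?] /andP[? ?]; apply/andP; lra.
apply: (powR_le_cancel r0 (ltW rho0)).
rewrite -lee_fin Lr_norm_pow -/(Ldist _ _).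
apply: le_trans (Ldist_triangle mF mf mG) _.
apply: (@le_trans _ _ (c%:E * (eta%:E + c%:E * (eta%:E + eta%:E)))%E).
  apply: lee_wpmul2l; first by rewrite lee_fin ltW.
  apply: leeD; first exact: Ff.
  apply: le_trans (Ldist_triangle mf mg mG) _.
  apply: lee_wpmul2l; first by rewrite lee_fin ltW.
  by apply: leeD; [exact: fg|rewrite LdistC].
rewrite -!(EFinD, EFinM) lee_fin.
have -> : rho `^ r = 3 * (c * (c * eta)) by rewrite /eta; field; rewrite gt_eqF.
have ceta : c * eta <= c * (c * eta) by rewrite ler_pM2l// ler_peMl// ltW.
have lin (a b : R) : b <= a -> b + (a + a) <= 3 * a by lra.
by rewrite !mulrDr; exact: lin.
Qed.

End Lr_separability.

(** * Scales *)

Section power_mean.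
Variable R : realType.

(** Convexity at the midpoint. The sharp constant is essential: a cruder one would make l bisections
    cost more than 2^(pl). *)
Lemma powR_mean2 (a b p : R) : 0 <= a -> 0 <= b -> 1 <= p ->
  (a + b) `^ p <= 2 `^ (p - 1) * (a `^ p + b `^ p).
Proof.
move=> a0 b0 p1; have p0 : 0 < p := lt_le_trans ltr01 p1.
have h01 : 0 <= (2^-1 : R) <= 1 by apply/andP; split; lra.
pose t : {i01 R} := Itv01 (proj1 (andP h01)) (proj2 (andP h01)).
have convE (x y : R) : conv t (x : R^o) (y : R^o) = 2^-1 * x + 2^-1 * y.
  by rewrite convRE/= /unstable.onem (_ : 1 - 2^-1 = 2^-1 :> R); last field.
have H : (2^-1 * a + 2^-1 * b) `^ p <= 2^-1 * a `^ p + 2^-1 * b `^ p.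
  rewrite -(convE a b) -(convE (a `^ p)).
  by apply: (@convex_powR R p p1 t a b); rewrite inE/= in_itv/= andbT.
move: H; rewrite -!mulrDr powRM ?addr_ge0//.
have <- : 2 `^ (- p) = 2^-1 `^ p :> R by rewrite -powR_inv1// -powRrM mulN1r.
rewrite powRN ler_pdivrMl ?powR_gt0// => H; apply: le_trans H _.
rewrite mulrA ler_wpM2r ?addr_ge0 ?powR_ge0//.
by rewrite -(mulr_powRB1 (ler0n R 2) p0) mulrAC divff// mul1r.
Qed.

Lemma pdist_triangle_mean (Y : normedModType R) (p : R) m n (f g h : nat -> Y) :
  1 <= p ->
  pdist p m n f h <= 2 `^ (p - 1) * (pdist p m n f g + pdist p m n g h).
Proof.
move=> p1; have p0 : 0 < p := lt_le_trans ltr01 p1.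
rewrite /pdist -big_split mulr_sumr; apply: ler_sum => k _.
by apply: le_trans (powR_mean2 _ _ p1) => //; rewrite powR_le_mono// ler_distD.
Qed.

(** Keep the larger of the steps found in the two halves: each halving then costs 2^(p - 1) times 2,
    that is 2^p. *)
Lemma bisection (G : nat -> nat -> R) (p : R) : 1 <= p ->
  (forall i j k, G i k <= 2 `^ (p - 1) * (G i j + G j k)) ->
  forall l i, exists2 h, (i <= h < i + 2 ^ l)%N &
    G i (i + 2 ^ l)%N <= 2 `^ (p * l%:R) * G h h.+1.
Proof.
move=> p1 GT; have p0 : 0 < p := lt_le_trans ltr01 p1.
elim=> [|l IH] i.
  by exists i; rewrite ?addn1 ?leqnn// mulr0 powRr0 mul1r.
pose m := (i + 2 ^ l)%N.
have [h1 /andP[ih1 hm1] H1] := IH i; have [h2 /andP[mh2 h2k] H2] := IH m.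
have kE : (i + 2 ^ l.+1 = m + 2 ^ l)%N by rewrite /m expnS; lia.
have step (x y z : R) : x <= 2 `^ (p * l%:R) * z -> y <= 2 `^ (p * l%:R) * z ->
    2 `^ (p - 1) * (x + y) <= 2 `^ (p * l.+1%:R) * z.
  move=> xz yz.
  have -> : 2 `^ (p * l.+1%:R) = 2 `^ (p - 1) * (2 * 2 `^ (p * l%:R)) :> R.
    rewrite mulrCA mulrA (mulr_powRB1 (ler0n R 2) p0) -[l.+1%:R]natr1 addrC.
    by rewrite mulrDr mulr1 powRD// pnatr_eq0 implybT.
  rewrite -!mulrA ler_pM2l ?powR_gt0//; lra.
rewrite kE; have c0 : 0 <= 2 `^ (p * l%:R) :> R by exact: powR_ge0.
have [h12|/ltW h21] := leP (G h1 h1.+1) (G h2 h2.+1).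
  exists h2; first by rewrite h2k andbT (leq_trans _ mh2)// leq_addr.
  apply: le_trans (GT i m _) _; apply: step => //.
  by apply: le_trans H1 _; rewrite ler_wpM2l.
exists h1; first by rewrite ih1 (leq_trans hm1)// leq_addr.
apply: le_trans (GT i m _) _; apply: step => //.
by apply: le_trans H2 _; rewrite ler_wpM2l.
Qed.

End power_mean.

Section separating_scales.
Variables (R : realType) (p q : R).
Hypotheses (p0 : 0 < p) (pq : p < q).

Let t (s : R) (l : nat) : R := 2 `^ (- (s * l%:R)).

(** A state is the current level with the sum of the terms taken at it so far. *)
Let scale (la : nat * R) : nat * R :=
  let a := la.2 + t p la.1 in if a < 1 then (la.1, a) else (la.1.+1, 0).

Let state n := iter n scale (0%N, 0).

Let t_ge0 s l : 0 <= t s l. Proof. exact: powR_ge0. Qed.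

Let t_le1 s l : 0 <= s -> t s l <= 1.
Proof.
move=> s0; rewrite /t powRN invf_le1 ?powR_gt0//.
by rewrite -[leLHS](powRr0 2) ler_powR ?ler1n// mulr_ge0.
Qed.

Let state_bounds n : 0 <= (state n).2 < 1.
Proof.
elim: n => [|n /andP[IH _]]; first by rewrite lexx ltr01.
rewrite /state iterS -/(state n) /scale; case: ifP => /= [->|_].
  by rewrite andbT addr_ge0// t_ge0.
by rewrite lexx ltr01.
Qed.

(* The level rises once the terms [2^(-pl)] of the current level add up to 1,
   so every level contributes between 1 and 2 to the first series, hence at most
   [2 * 2^(-(q-p)l)] to the second. *)
Lemma separating_scales : exists l : nat -> nat,
  bddsum (fun j => t q (l j)) /\ ~ bddsum (fun j => t p (l j)).
Proof.
exists (fun j => (state j).1); split; last first.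
  move=> [M HM].
  have levels n : ((state n).1)%:R + (state n).2 <= \sum_(i < n) t p (state i).1.
    elim: n => [|n IH]; first by rewrite big_ord0 addr0.
    rewrite big_ord_recr/= -/(state n) /scale; case: ltP => /= [_|le1].
      by rewrite addrA lerD2r.
    by rewrite -[_.+1%:R]natr1; lra.
  have [N MN] : exists N : nat, M < N%:R by exists (Num.truncn M).+1; exact: truncnS_gt.
  have lN n : ((state n).1 <= N)%N.
    rewrite -(ler_nat R); apply: le_trans (ltW MN); apply: le_trans (HM n).
    by apply: le_trans (levels n); rewrite lerDl; case/andP: (state_bounds n).
  apply: (@bddsum_ge R (fun j => t p (state j).1) (t p N)).
  - exact: powR_gt0.
  - by move=> j; rewrite /t ler_powR ?ler1n// lerN2 ler_pM2l// ler_nat.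
  - by exists M.
pose th : R := 2 `^ (p - q).
have th0 : 0 < th by rewrite powR_gt0.
have th1 : th < 1.
  rewrite /th -opprB powRN invf_lt1 ?powR_gt0//.
  apply: (@le_lt_trans _ _ (1 `^ (q - p))); first by rewrite powR1.
  by rewrite gt0_ltr_powR ?subr_gt0 ?nnegrE ?ltr1n.
have tqp l : t q l = th ^+ l * t p l.
  rewrite -powR_mulrn ?(ltW th0)// /th -powRrM /t -powRD ?pnatr_eq0 ?implybT//.
  by congr (_ `^ _); ring.
exists (2 / (1 - th)) => n.
have th10 : 0 < 1 - th by rewrite subr_gt0.
(* A finished level i accounts for at most 2 th^i, which sums to the first term; the second is the
   exact contribution of the current level. *)
suff bnd : \sum_(i < n) t q (state i).1 <=
    2 * (1 - th ^+ (state n).1) / (1 - th) + th ^+ (state n).1 * (state n).2.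
  apply: le_trans bnd _; have /andP[s0 s1] := state_bounds n.
  rewrite ler_pdivlMr// mulrDl divfK ?gt_eqF// -mulrA.
  have : th ^+ (state n).1 * ((state n).2 * (1 - th)) <= th ^+ (state n).1 * 1.
    rewrite ler_wpM2l ?exprn_ge0 ?(ltW th0)// mulr_ile1// ltW// ltrBlDr ltrDl//.
  have : 0 <= th ^+ (state n).1 by rewrite exprn_ge0 ?(ltW th0).
  set u := th ^+ _; set v := u * _; lra.
elim: n => [|n IH].
  by rewrite big_ord0 expr0 subrr mulr0 mul0r mulr0 addr0.
rewrite big_ord_recr/= -/(state n) tqp.
have /andP[s0 s1] := state_bounds n.
have E0 : 0 <= th ^+ (state n).1 by rewrite exprn_ge0 ?(ltW th0).
rewrite /scale; case: ltP => /= [_|_].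
  by rewrite [th ^+ _ * (_ + _)]mulrDr addrA lerD2r.
rewrite mulr0 addr0 exprS.
have split (u v : R) : 0 < 1 - v ->
    2 * (1 - v * u) / (1 - v) = 2 * (1 - u) / (1 - v) + 2 * u.
  by move=> v1; field; rewrite gt_eqF.
rewrite (split (th ^+ (state n).1) th th10).
apply: le_trans (lerD IH (lexx _)) _; rewrite -addrA lerD2l -mulrDr mulrC.
rewrite ler_wpM2r// (le_trans (lerD (ltW s1) (t_le1 _ (ltW p0))))//.
Qed.

End separating_scales.

(** * Non-reducibility *)

Section rank_metric_in_c0.
Variables (R : realType) (n : nat) (e : R).
Hypothesis e0 : 0 <= e.
Local Notation V := 'M['F_2]_n.

Definition rank_dist (M M' : V) : R := (\rank (M - M')%R)%:R.

Lemma rank_dist_triangle M M' M'' :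
  rank_dist M M'' <= rank_dist M M' + rank_dist M' M''.
Proof.
rewrite /rank_dist -natrD ler_nat -(subrKA M'); exact: mxrank_add.
Qed.

Lemma rank_distC M M' : rank_dist M M' = rank_dist M' M.
Proof. by rewrite /rank_dist -mxrank_opp opprB. Qed.

(** Frechet embedding of a finite metric space: coordinate m is the distance to the m-th point,
    padded by zeros. *)
Definition rank_seq (M : V) (m : nat) : R :=
  if (m < size (enum {: V}))%N then e * rank_dist M (nth 0 (enum {: V}) m) else 0.

Lemma rank_seq_null M : rank_seq M \in @null_sequence R.
Proof.
apply: null_sequenceP => d d0; exists (size (enum {: V})) => m Vm.
by rewrite /rank_seq ltnNge Vm/= normr0 ltW.
Qed.

Definition rank_embed (M : V) : c0 R := C0 (rank_seq_null M).

Lemma rank_embed_isometry M M' : `|rank_embed M - rank_embed M'| = e * rank_dist M M'.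
Proof.
apply/le_anti/andP; split.
  apply: c0_norm_le => m; rewrite c0_subE /= /rank_seq; case: ifP => _; last first.
    by rewrite subrr normr0 mulr_ge0.
  rewrite -mulrBr normrM (ger0_norm e0) ler_wpM2l// ler_norml.
  set x := nth _ _ _.
  have := rank_dist_triangle M M' x; have := rank_dist_triangle M' M x.
  by rewrite (rank_distC M' M) => h1 h2; apply/andP; lra.
have M'V : M' \in enum {: V} by rewrite mem_enum.
apply: le_trans (c0_norm_ge _ (index M' (enum {: V}))).
rewrite c0_subE/= /rank_seq index_mem M'V nth_index// -mulrBr.
by rewrite /rank_dist subrr mxrank0 subr0 ler_norm.
Qed.

End rank_metric_in_c0.

Section c0_not_in_Lr.
Variables (R : realType) (r p q : R) (r1 : 1 <= r).
Hypotheses (p1 : 1 <= p) (q1 : 1 <= q).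

Let k (j : nat) : nat := (2 ^ j)%N.
Local Notation V j := ('M['F_2]_((k j).*2.+1)).
Local Notation A := {j : nat & V j}.

(** Matrices of all sizes form one countable alphabet; the tag j fixes both the size and the scaling
    2^-j of the rank metric. *)
Let dec (a : A) : c0 R := rank_embed (2 ^- tag a : R) (tagged a).

Lemma E_c0_not_reducible_Lr : ~ borel_reducible (E (c0 R) p) (E (Lr r1) q).
Proof.
move=> red.
pose F j := [seq Tagged (fun j => V j) M | M <- enum {: V j}].
pose b j : A := Tagged (fun j => V j) (0 : V j).
have FV j (M : V j) : Tagged (fun j => V j) M \in F j.
  by apply: map_f; rewrite mem_enum.
have [K [psi H]] := @additive_reduction R (c0 R) (Lr r1) p q A (b 0%N) dec p1 q1 F b
  (fun j => FV j 0) (Lr_separable r1) red.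
have [C C0 HC] := poincare_walk_Lr r1 q1.
pose tg j (M : V j) : A := Tagged (fun j => V j) M.
pose N j (a a' : A) := pdist q (K j) (K j.+1) (psi j a) (psi j a').
have decE j (M M' : V j) :
    `|dec (tg j M) - dec (tg j M')| = 2 ^- j * rank_dist R M M'.
  by apply: rank_embed_isometry; rewrite invr_ge0 exprn_ge0.
have pairs j : exists u : A * A * A * A, [/\ u.1.1.1 \in F j, u.1.1.2 \in F j,
    u.1.2 \in F j & u.2 \in F j] /\ [/\ 1 <= `|dec u.1.1.1 - dec u.1.1.2|,
    `|dec u.1.2 - dec u.2| <= 2 ^- j & N j u.1.1.1 u.1.1.2 <= 2 * C * N j u.1.2 u.2].
  have [||v [v' [e [e' [far edge NC]]]]] :=
    @exists_far_pair R (k j) C (fun M M' => N j (tg j M) (tg j M')) C0.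
  - by move=> M M'; exact: pdist_ge0.
  (* The Poincare inequality is applied in each coordinate l of the block and summed, since [pdist]
     is a sum of q-th powers. *)
  - rewrite /N /pdist; under eq_bigr do rewrite exchange_big/=.
    rewrite exchange_big/= [X in _ <= _ * X](_ : _ = \sum_(K j <= l < K j.+1)
      \sum_M \sum_M' walk R M M' * `|psi j (tg j M) l - psi j (tg j M') l| `^ q).
      rewrite mulr_sumr; apply: ler_sum => l _.
      exact: (HC _ (fun M => psi j (tg j M) l)).
    under eq_bigr do under eq_bigr do rewrite mulr_sumr.
    by under eq_bigr do rewrite exchange_big/=; rewrite exchange_big.
  exists (tg j v, tg j v', tg j e, tg j e'); split; first by split; exact: FV.
  split=> //=; rewrite decE /rank_dist.
    by rewrite ler_pdivlMl ?exprn_gt0// mulr1 -natrX ler_nat ltnW.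
  by rewrite ler_piMr ?invr_ge0 ?exprn_ge0// lern1.
have /choice[u Hu] := pairs.
have edges : bddsum (fun j => `|dec (u j).1.2 - dec (u j).2| `^ p).
  apply: bddsum_le (bddsum_geometric R) => j.
  have [_ [_ ue _]] := Hu j; have p0 : 0 < p := lt_le_trans ltr01 p1.
  apply: le_trans (powR_le_mono p0 (normr_ge0 _) ue) _.
  apply: ge1r_powR => //; rewrite invr_gt0 exprn_gt0//= invf_le1 ?exprn_gt0//.
  by rewrite exprn_ege1// ler1n.
have Nedges := proj1 (H (fun j => (u j).1.2) (fun j => (u j).2)
  (fun j => let: conj (And4 _ _ h _) _ := Hu j in h)
  (fun j => let: conj (And4 _ _ _ h) _ := Hu j in h)) edges.
have Nfar : bddsum (fun j => N j (u j).1.1.1 (u j).1.1.2).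
  apply: bddsum_le (bddsumZ (_ : 0 <= 2 * C) Nedges) => [j|]; last by rewrite mulr_ge0.
  by have [_ []] := Hu j.
have := proj2 (H (fun j => (u j).1.1.1) (fun j => (u j).1.1.2)
  (fun j => let: conj (And4 h _ _ _) _ := Hu j in h)
  (fun j => let: conj (And4 _ h _ _) _ := Hu j in h)) Nfar.
apply: (bddsum_ge ltr01) => j; have [_ [far _ _]] := Hu j.
apply: (@le_trans _ _ (1 `^ p)); first by rewrite powR1.
by rewrite powR_le_mono// (lt_le_trans ltr01 p1).
Qed.

End c0_not_in_Lr.

(** * Strictness in the exponent *)

Section c0_exponents.
Variables (R : realType) (p q : R).
Hypotheses (p1 : 1 <= p) (pq : p < q).

Let p0 : 0 < p := lt_le_trans ltr01 p1.
Let q1 : 1 <= q := le_trans p1 (ltW pq).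

Lemma spike_null (t : R) : (fun n => if n == 0%N then t else 0) \in @null_sequence R.
Proof.
by apply: null_sequenceP => d d0; exists 1%N => -[//|n] _; rewrite normr0 ltW.
Qed.

Definition spike (t : R) : c0 R := C0 (spike_null t).

Lemma spike_isometry s t : `|spike s - spike t| = `|s - t|.
Proof.
apply/le_anti/andP; split; last exact: (c0_norm_ge (spike s - spike t) 0%N).
by apply: c0_norm_le => -[|n]; rewrite c0_subE//= subrr normr0.
Qed.

(* A term is selected when it is at most [2^(-c)], [c] being the number of terms
   selected before it. *)
Lemma sparse_selection (a : nat -> R) : (forall j, 0 <= a j) ->
  (forall c J, 0 < c -> exists2 j, (J <= j)%N & a j < c) ->
  exists sel : nat -> bool, bddsum (fun j => (sel j)%:R * a j) /\
    ~ bddsum (fun j => (sel j)%:R : R).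
Proof.
move=> a0 small.
pose step (c j : nat) : nat := (c + (a j <= 2 ^- c)%R)%N.
pose cnt := fix cnt j := if j is i.+1 then step (cnt i) i else 0%N.
pose sel j := a j <= 2 ^- cnt j.
have sumE n : \sum_(j < n) (sel j)%:R = (cnt n)%:R :> R.
  by elim: n => [|n IH]; rewrite ?big_ord0// big_ord_recr/= IH -natrD.
have mono m n : (m <= n)%N -> (cnt m <= cnt n)%N.
  elim: n => [|n IH]; first by rewrite leqn0 => /eqP->.
  rewrite leq_eqVlt => /predU1P[->//|]; rewrite ltnS => /IH mn.
  exact: leq_trans mn (leq_addr _ _).
exists sel; split.
  exists 2 => n; suff : \sum_(j < n) (sel j)%:R * a j <= 2 - 2 * 2 ^- cnt n.
    by move/le_trans; apply; rewrite lerBlDr lerDl mulr_ge0// invr_ge0 exprn_ge0.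
  elim: n => [|n IH]; first by rewrite big_ord0 expr0 invr1 mulr1 subrr.
  rewrite big_ord_recr/= /step -/(sel n); case: (boolP (sel n)) => seln.
    rewrite /= mul1r addn1 exprS invfM mulVKf ?pnatr_eq0//.
    by move: IH (seln : a n <= 2 ^- cnt n); move: (2 ^- cnt n) => x; lra.
  by rewrite /= mul0r addr0 addn0.
move=> [M HM].
have unbounded c : exists n, (c <= cnt n)%N.
  elim: c => [|c [n cn]]; first by exists 0%N.
  have [j nj aj] := small (2 ^- c) n ltac:(by rewrite invr_gt0 exprn_gt0).
  have [cj|jc] := ltnP c (cnt j); first by exists j.
  exists j.+1 => /=; rewrite /step.
  have -> : cnt j = c by apply/eqP; rewrite eqn_leq jc (leq_trans cn (mono _ _ nj)).
  by rewrite (ltW aj) addn1.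
have [n Mn] := unbounded (Num.truncn M).+1.
have := HM n; rewrite sumE leNgt => /negP; apply.
by apply: lt_le_trans (truncnS_gt M) _; rewrite ler_nat.
Qed.

Lemma E_c0_not_reducible_lower : ~ borel_reducible (E (c0 R) q) (E (c0 R) p).
Proof.
move=> red; have [l [lq lp]] := separating_scales p0 pq.
pose dec (a : nat * nat) := spike (a.2%:R / 2 ^+ a.1).
pose F j := [seq (l j, i) | i <- iota 0 (2 ^ l j).+1].
have Fl j i : (i <= 2 ^ l j)%N -> (l j, i) \in F j.
  by move=> il; apply: map_f; rewrite mem_iota.
have [K [psi H]] := @additive_reduction R (c0 R) (c0 R) q p (nat * nat)%type
  (0%N, 0%N) dec q1 p1 F (fun j => (l j, 0%N)) (fun j => Fl j 0%N (leq0n _))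
  (c0_separable R) red.
pose N j i i' := pdist p (K j) (K j.+1) (psi j (l j, i)) (psi j (l j, i')).
pose a j := N j 0%N (2 ^ l j)%N.
have decE j i i' : `|dec (l j, i) - dec (l j, i')| = `|i%:R - i'%:R| / 2 ^+ l j.
  have l0 : 0 <= (2 ^+ l j)^-1 :> R by rewrite invr_ge0 exprn_ge0.
  by rewrite spike_isometry/= -mulrBl normrM (ger0_norm l0).
have a0 j : 0 <= a j by exact: pdist_ge0.
(* The images of the ends of the segments stay apart: otherwise a sparse set of j has summable
   images, although the ends, at distance 1 for infinitely many selected j, are not summable. *)
have [c [J [c0 aJ]]] : exists c J, 0 < c /\ forall j, (J <= j)%N -> c <= a j.
  apply: contrapT => nc.
  have small c J : 0 < c -> exists2 j, (J <= j)%N & a j < c.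
    move=> c0; apply: contrapT => nj; apply: nc; exists c, J; split => // j Jj.
    by rewrite leNgt; apply/negP => ajc; apply: nj; exists j.
  have [sel [sa nsel]] := sparse_selection a0 small; apply: nsel.
  pose y j := (l j, sel j * 2 ^ l j)%N.
  have yF j : y j \in F j by apply: Fl; case: (sel j); rewrite ?mul1n ?mul0n.
  have /(proj2 (H (fun j => (l j, 0%N)) y (fun j => Fl j 0%N (leq0n _)) yF)) :
      bddsum (fun j => N j 0%N (sel j * 2 ^ l j)%N).
    apply: bddsum_le sa => j; case: (sel j); first by rewrite mul1n mul1r.
    by rewrite mul0n mul0r /N pdistxx.
  apply: bddsum_le => j; rewrite decE; case: (sel j); last exact: powR_ge0.
  rewrite mul1n sub0r normrN ger0_norm// natrX divff ?expf_neq0 ?pnatr_eq0//.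
  by rewrite powR1.
have bis j := @bisection R (N j) p p1
  (fun i i' i'' => pdist_triangle_mean (K j) (K j.+1) _ _ _ p1) (l j) 0%N.
have /choice[h Hh] : forall j, exists h, (h < 2 ^ l j)%N /\
    a j <= 2 `^ (p * (l j)%:R) * N j h h.+1.
  by move=> j; have [h] := bis j; rewrite add0n => /= hl Nh; exists h.
have steps : bddsum (fun j => N j (h j) (h j).+1).
  have hF j : (l j, h j) \in F j by apply/Fl/ltnW; have [] := Hh j.
  have hF1 j : (l j, (h j).+1) \in F j by apply: Fl; have [] := Hh j.
  apply: (proj1 (H (fun j => (l j, h j)) (fun j => (l j, (h j).+1)) hF hF1)).
  apply: bddsum_le lq => j; rewrite decE -[(h j).+1%:R]natr1 opprD addrA subrr.
  rewrite sub0r normrN1 mul1r -powR_invn ?ler0n// -powRrM mulNr mulrC; exact: lexx.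
apply: lp.
(* From J on, bisection and the lower bound c on [a j] control 2^(-pl); the finitely many earlier
   terms are at most 1. *)
apply: (@bddsum_le _ _ (fun j => c^-1 * N j (h j) (h j).+1 + (j < J)%N%:R)).
  move=> j; have [jJ|Jj] := ltnP j J.
    apply: (@le_trans _ _ 1); last first.
      by rewrite lerDr mulr_ge0 ?invr_ge0 ?(ltW c0)// pdist_ge0.
    rewrite powRN invf_le1 ?powR_gt0//.
    by rewrite -[leLHS](powRr0 2) ler_powR ?ler1n// mulr_ge0// ltW.
  rewrite addr0 ler_pdivlMl// powRN ler_pdivrMr ?powR_gt0// mulrC.
  by apply: le_trans (aJ j Jj) _; have [] := Hh j.
apply: bddsumD; first by apply: bddsumZ => //; rewrite invr_ge0 ltW.
apply: (@bddsum_finite_support _ _ J) => // j Jj.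
by rewrite ltnNge Jj.
Qed.

End c0_exponents.

Theorem theorem6p8 (R : realType) (r p : R) (r1 : 1 <= r) (p1 : 1 <= p) :
  [/\ borel_bireducible (E (C01 R) p) (E (c0 R) p),
      borel_reducible (E (Lr r1) p) (E (c0 R) p),
      (forall q : R, 1 <= q -> ~ borel_reducible (E (c0 R) p) (E (Lr r1) q)) &
      (forall q : R, 1 <= q -> p < q ->
        borel_strictly_reducible (E (c0 R) p) (E (c0 R) q))].
Proof.
have p0 : 0 < p := lt_le_trans ltr01 p1.
split.
- split; last exact: E_reducible_c0_C01.
  exact: E_reducible_c0 (C01_separable R) p0 (lexx p).
- exact: E_reducible_c0 (Lr_separable r1) p0 (lexx p).
- by move=> q q1; exact: E_c0_not_reducible_Lr.
- move=> q q1 pq; split; last exact: E_c0_not_reducible_lower.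
  exact: E_reducible_c0 (c0_separable R) p0 (ltW pq).
Qed.
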